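(* Let $c\neq 0$. There does not exist any semi parallel proper CR-submanifold $M$ in the complex space form $\hat M_n(c)$ with $\dim_{\mathbb C}\mathcal D\geq 2$, where $\mathcal D$ is the holomorphic distribution of $M$.
   Context: $\hat M_n(c)$ denotes an $n$-dimensional complex space form: a complete, simply connected Kaehler manifold of complex dimension $n$ with constant holomorphic sectional curvature $4c$; $J$ is its complex structure. CR-submanifolds: let $M$ be an isometrically immersed submanifold of a Kaehler manifold, with normal bundle $TM^\perp$. For $x\in M$ put $\mathcal D_x=T_xM\cap JT_xM$. $M$ is generic if $\dim\mathcal D_x$ is constant along $M$; then $\mathcal D$ is called the holomorphic distribution. A generic submanifold is a CR-submanifold if the orthogonal complement $\mathcal D^\perp$ of $\mathcal D$ in $TM$ satisfies $J\mathcal D^\perp\subset TM^\perp$. It is holomorphic if $\mathcal D^\perp=\{0\}$, totally real if $\mathcal D=\{0\}$, and proper if it is neither holomorphic nor totally real. Semi parallel: let $h$ be the second fundamental form of $M$, and $R$, $R^\perp$ the curvature tensors of the Levi-Civita connection and the normal connection of $M$. $M$ is semi parallel if $$(\bar R(X,Y)h)(Z,W):=R^\perp(X,Y)h(Z,W)-h(R(X,Y)Z,W)-h(Z,R(X,Y)W)=0$$ for all $X,Y,Z,W$ tangent to $M$. *)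

(* Defs.v *)
(* Built on MathComp and MathComp-Analysis. *)
From HB Require Import structures.
From mathcomp Require Import all_boot all_order all_algebra.
From mathcomp Require Import all_classical all_reals all_analysis.

Set Implicit Arguments.
Unset Strict Implicit.
Unset Printing Implicit Defensive.

Import Order.TTheory GRing.Theory Num.Theory.
Import numFieldNormedType.Exports.
Local Open Scope classical_set_scope.
Local Open Scope ring_scope.

(* C^infinity on U (meant to be open): every iterated directional derivative
   is Frechet differentiable at each point of U.  Between finite-dimensional
   spaces this is the usual notion. *)
Definition smooth_on {R : realType} {V W : normedModType R}
    (U : set V) (f : V -> W) : Prop :=
  forall (vs : seq V) (p : V), U p ->
    differentiable (foldr (fun v h => fun q => 'D_v h q) f vs) p.

(* The functions cmap and cinv are total; only their values on cdom, resp. on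
   the image of cdom, are meaningful. *)
Record chart (R : realType) (T : topologicalType) (m : nat) := Chart {
  cdom : set T ;
  cmap : T -> 'rV[R]_m ;
  cinv : 'rV[R]_m -> T ;
  cdom_open : open cdom ;
  cimg_open : open (cmap @` cdom) ;
  cmapK : forall x, cdom x -> cinv (cmap x) = x ;
  cmap_continuous : forall x, cdom x -> {for x, continuous cmap} ;
  cinv_continuous : forall x, cdom x -> {for cmap x, continuous cinv}
}.

(* The map f read in the charts phi and psi, and its domain. *)
Definition local_expr {R : realType} {S T : topologicalType} {m n : nat}
    (f : S -> T) (phi : chart R S m) (psi : chart R T n)
    : 'rV[R]_m -> 'rV[R]_n :=
  fun p => cmap psi (f (cinv phi p)).

Definition local_dom {R : realType} {S T : topologicalType} {m n : nat}
    (f : S -> T) (phi : chart R S m) (psi : chart R T n) : set 'rV[R]_m :=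
  cmap phi @` (cdom phi `&` f @^-1` cdom psi).

Record manifold (R : realType) (m : nat) := Manifold {
  carrier :> topologicalType ;
  atlas : set (chart R carrier m) ;
  manifold_hausdorff : hausdorff_space carrier ;
  manifold_second_countable : @second_countable carrier ;
  atlas_cover : forall x : carrier, exists2 phi, atlas phi & cdom phi x ;
  atlas_smooth : forall phi psi, atlas phi -> atlas psi ->
    smooth_on (local_dom idfun phi psi) (local_expr idfun phi psi)
}.

(* Inner product of row vectors with Gram matrix g. *)
Definition ip {R : realType} {m : nat} (g : 'M[R]_m) (u v : 'rV[R]_m) : R :=
  (u *m g *m v^T) 0 0.

(* metric phi p is the Gram matrix, at the point of coordinates p, of the
   coordinate frame of the chart phi. *)
Record riemannian (R : realType) (m : nat) := Riemannian {
  rman :> manifold R m ;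
  metric : chart R rman m -> 'rV[R]_m -> 'M[R]_m ;
  metric_smooth : forall phi, atlas phi ->
    smooth_on (cmap phi @` cdom phi) (metric phi) ;
  metric_sym : forall phi x, atlas phi -> cdom phi x ->
    (metric phi (cmap phi x))^T = metric phi (cmap phi x) ;
  metric_pos : forall phi x (u : 'rV[R]_m), atlas phi -> cdom phi x ->
    u != 0 -> 0 < ip (metric phi (cmap phi x)) u u ;
  metric_change : forall phi psi x (u v : 'rV[R]_m),
    atlas phi -> atlas psi -> cdom phi x -> cdom psi x ->
    let tau := local_expr idfun phi psi in
    ip (metric psi (cmap psi x)) ('D_u tau (cmap phi x)) ('D_v tau (cmap phi x))
      = ip (metric phi (cmap phi x)) u v
}.

Section LocalGeometry.
Context {R : realType} {m : nat}.
Implicit Types (g : 'rV[R]_m -> 'M[R]_m) (p u v w : 'rV[R]_m).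

(* The vector Gamma_p(u, v) determined, for all w, by
   2 <Gamma(u,v), w> = d_u <v,w> + d_v <u,w> - d_w <u,v>,
   where u, v, w are extended with constant components. *)
Definition christoffel g p u v : 'rV[R]_m :=
  (\row_k (2^-1 * ('D_u (fun q => ip (g q) v (delta_mx 0 k)) p
                 + 'D_v (fun q => ip (g q) u (delta_mx 0 k)) p
                 - 'D_(delta_mx 0 k) (fun q => ip (g q) u v) p)))
  *m invmx (g p).

(* Levi-Civita covariant derivative of the vector field Y in direction u. *)
Definition nabla g u (Y : 'rV[R]_m -> 'rV[R]_m) p : 'rV[R]_m :=
  'D_u Y p + christoffel g p u (Y p).

(* R(u,v)w = nabla_u nabla_v w - nabla_v nabla_u w - nabla_[u,v] w, computed
   with the extensions of u, v, w having constant components in the chart,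
   for which [u,v] = 0. *)
Definition riemann g p u v w : 'rV[R]_m :=
  nabla g u (nabla g v (cst w)) p - nabla g v (nabla g u (cst w)) p.

End LocalGeometry.

(* Multiplication by 'i on C^n = R^n x R^n, acting on row vectors (x, y) by
   (x, y) *m Jmx = (- y, x). *)
Definition Jmx (R : realType) (n : nat) : 'M[R]_(n + n) :=
  block_mx 0 1%:M (- 1%:M) 0.

(* Complex dimension n: the charts are holomorphic coordinates, so that the
   complex structure J reads Jmx in each of them. *)
Record kaehler (R : realType) (n : nat) := Kaehler {
  kman :> riemannian R (n + n) ;
  transition_holomorphic : forall (phi psi : chart R kman (n + n)) x u,
    atlas phi -> atlas psi -> cdom phi x -> cdom psi x ->
    let tau := local_expr idfun phi psi in
    'D_(u *m Jmx R n) tau (cmap phi x) = 'D_u tau (cmap phi x) *m Jmx R n ;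
  metric_hermitian : forall (phi : chart R kman (n + n)) x u v,
    atlas phi -> cdom phi x ->
    ip (metric phi (cmap phi x)) (u *m Jmx R n) (v *m Jmx R n)
      = ip (metric phi (cmap phi x)) u v ;
  J_parallel : forall (phi : chart R kman (n + n)) x u w,
    atlas phi -> cdom phi x ->
    nabla (metric phi) u (cst (w *m Jmx R n)) (cmap phi x)
      = nabla (metric phi) u (cst w) (cmap phi x) *m Jmx R n
}.

Definition geodesic {R : realType} {m : nat} (N : riemannian R m)
    (gam : R -> N) : Prop :=
  continuous gam /\
  forall (phi : chart R N m) (t : R), atlas phi -> cdom phi (gam t) ->
    let c : R -> 'rV[R]_m := cmap phi \o gam in
    [/\ derivable c t 1, derivable (derive1 c) t 1 &
        derive1 (derive1 c) t
          + christoffel (metric phi) (c t) (derive1 c t) (derive1 c t) = 0].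

(* Geodesic completeness: each tangent vector is the initial velocity of a
   geodesic defined on the whole real line. *)
Definition complete_riemannian {R : realType} {m : nat}
    (N : riemannian R m) : Prop :=
  forall (phi : chart R N m) x (v : 'rV[R]_m), atlas phi -> cdom phi x ->
    exists gam : R -> N,
      [/\ geodesic gam, gam 0 = x & derive1 (cmap phi \o gam) 0 = v].

(* Paths and homotopies are parametrised by the unit interval and extended
   continuously to R, resp. R * R, which is no restriction. *)
Definition simply_connected (R : realType) (T : topologicalType) : Prop :=
  (forall x y : T, exists gam : R -> T,
     [/\ continuous gam, gam 0 = x & gam 1 = y]) /\
  (forall gam : R -> T, continuous gam -> gam 0 = gam 1 ->
     exists H : R * R -> T,
       [/\ continuous H,
           forall t, 0 <= t <= 1 -> H (0, t) = gam t,
           forall t, 0 <= t <= 1 -> H (1, t) = gam 0 &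
           forall s, 0 <= s <= 1 -> H (s, 0) = gam 0 /\ H (s, 1) = gam 0]).

(* For a vector u of norm r the left-hand side below is r ^+ 4 times the
   sectional curvature of the plane spanned by u and J u. *)
Definition complex_space_form {R : realType} {n : nat} (c : R)
    (N : kaehler R n) : Prop :=
  [/\ complete_riemannian N,
      simply_connected R N &
      forall (phi : chart R N (n + n)) x u, atlas phi -> cdom phi x ->
        let p := cmap phi x in
        let g := metric phi in
        let Ju := u *m Jmx R n in
        ip (g p) (riemann g p u Ju Ju) u = 4 * c * ip (g p) u u ^+ 2].

Section Submanifolds.
Context {R : realType} {m n : nat} {M : riemannian R m} {N : kaehler R n}.
Variable f : M -> N.
Implicit Types (phi : chart R M m) (psi : chart R N (n + n)).
Implicit Types (p u v z w : 'rV[R]_m) (xi : 'rV[R]_m -> 'rV[R]_(n + n)).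

Definition isometric_immersion : Prop :=
  continuous f /\
  forall phi psi, atlas phi -> atlas psi ->
    smooth_on (local_dom f phi psi) (local_expr f phi psi) /\
    forall p u v, local_dom f phi psi p ->
      ip (metric psi (local_expr f phi psi p))
         ('D_u (local_expr f phi psi) p) ('D_v (local_expr f phi psi) p)
        = ip (metric phi p) u v.

(* Below, vectors tangent to M at a point are row vectors of components in the
   chart phi, and vectors tangent to N are row vectors of components in psi.
   Subspaces of the tangent space of N are row spaces of matrices. *)

Definition tangent_space phi psi p : 'M[R]_(m, n + n) :=
  jacobian (local_expr f phi psi) p.

Definition holo_space phi psi p : 'M[R]_(n + n) :=
  (tangent_space phi psi p :&: tangent_space phi psi p *m Jmx R n)%MS.

Definition holo_orth phi psi p (a : 'rV[R]_(n + n)) : Prop :=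
  (a <= tangent_space phi psi p)%MS /\
  forall b : 'rV[R]_(n + n), (b <= holo_space phi psi p)%MS ->
    ip (metric psi (local_expr f phi psi p)) a b = 0.

(* The holomorphic distribution has constant complex dimension k. *)
Definition generic (k : nat) : Prop :=
  forall phi psi p, atlas phi -> atlas psi -> local_dom f phi psi p ->
    \rank (holo_space phi psi p) = k.*2.

Definition CR_submanifold (k : nat) : Prop :=
  generic k /\
  forall phi psi p, atlas phi -> atlas psi -> local_dom f phi psi p ->
    forall a b : 'rV[R]_(n + n),
      holo_orth phi psi p a -> (b <= tangent_space phi psi p)%MS ->
      ip (metric psi (local_expr f phi psi p)) (a *m Jmx R n) b = 0.

Definition holomorphic_submanifold : Prop :=
  forall phi psi p, atlas phi -> atlas psi -> local_dom f phi psi p ->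
    forall a, holo_orth phi psi p a -> a = 0.

Definition totally_real_submanifold : Prop :=
  forall phi psi p, atlas phi -> atlas psi -> local_dom f phi psi p ->
    forall a : 'rV[R]_(n + n), (a <= holo_space phi psi p)%MS -> a = 0.

Definition proper_submanifold : Prop :=
  ~ holomorphic_submanifold /\ ~ totally_real_submanifold.

(* Levi-Civita connection of N along f: xi is a field along f of vectors
   tangent to N. *)
Definition nabla_along phi psi u xi p : 'rV[R]_(n + n) :=
  let F := local_expr f phi psi in
  'D_u xi p + christoffel (metric psi) (F p) ('D_u F p) (xi p).

(* Gauss formula, applied to the extension of v with constant components. *)
Definition second_form phi psi u v p : 'rV[R]_(n + n) :=
  let F := local_expr f phi psi in
  nabla_along phi psi u (fun q => 'D_v F q) p
    - 'D_(nabla (metric phi) u (cst v) p) F p.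

(* Orthogonal projection on the normal space: A has the coordinate basis of the
   tangent space of M as rows, and A G A^T is its Gram matrix. *)
Definition normal_part phi psi p (a : 'rV[R]_(n + n)) : 'rV[R]_(n + n) :=
  let A := tangent_space phi psi p in
  let G := metric psi (local_expr f phi psi p) in
  a - a *m G *m A^T *m invmx (A *m G *m A^T) *m A.

Definition normal_nabla phi psi u xi p : 'rV[R]_(n + n) :=
  normal_part phi psi p (nabla_along phi psi u xi p).

(* Curvature of the normal connection, for a normal field xi; as in riemann,
   u and v are extended with constant components. *)
Definition normal_curvature phi psi u v xi p : 'rV[R]_(n + n) :=
  normal_nabla phi psi u (normal_nabla phi psi v xi) p
    - normal_nabla phi psi v (normal_nabla phi psi u xi) p.

Definition semi_parallel : Prop :=
  forall phi psi p, atlas phi -> atlas psi -> local_dom f phi psi p ->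
    forall u v z w,
      normal_curvature phi psi u v (second_form phi psi z w) p
        - second_form phi psi (riemann (metric phi) p u v z) w p
        - second_form phi psi z (riemann (metric phi) p u v w) p = 0.

End Submanifolds.

(* Main.v *)
Require Import Defs.
From mathcomp Require Import all_boot all_order all_algebra.
From mathcomp Require Import all_classical all_reals all_analysis.
From mathcomp Require Import ring lra zify.

(* Let T be the differential of the immersion, h the second fundamental form,
   D the holomorphic distribution, D' its orthogonal complement in TM.  Insert
   the Gauss and Ricci equations into the semi-parallelity condition, pair it
   with a normal vector V and sum cyclically over X, Y, Z: the terms cubic in h
   cancel, and so does the first Bianchi sum.  What remains is linear in h,
     sum over the cyclic permutations of X, Y, Z of
       < K(X, Y) h(Z, W), V > - < K(X, Y) W, A_V Z > = 0,
   with K the curvature of the space form.  When dim_C D >= 2 it forces, at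
   every point, h(D, D') = 0, J h(D', D') tangent to M, and
   < h(X, Y), J U > = < X, Y > < L, U > for X, Y in D and U in D', where L is
   some vector of D'.  Differentiating h(D, D') = 0 and using the Codazzi
   equation gives
     < h(L, W), J U > = < L, W > < L, U > - c < W, U >   (U, W in D').
   If L = 0 then c = 0.  If L <> 0, semi-parallelity at (X, L; X, L), X in D,
   tested against J L, gives c |L|^4 = 0. *)

(** The dimension hypothesis enters through one fact, [holo_dim]: for every tangent Z there is a
    nonzero X in D with X and J X both orthogonal to Z, because these are two linear conditions on a
    space of real dimension at least four. Taking Y = J X in the cyclic identity then makes nearly
    every term vanish and isolates one value of h. Differentiating h(D, D') = 0 calls for smooth
    fields of D and D'. Instead of local frames, the tangential part P of J supplies them: P maps TM
    onto D and I + P^2 is the projection onto D', so P x and y + P^2 y, with x and y constant in the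
    chart, are smooth fields. Since J is parallel, the covariant derivative of P is expressed by h.
    The algebra is stated for abstract vector spaces and used twice: at every point of a chart
    domain, to get h(D, D') = 0 there, and then at one point, once that identity has been
    differentiated. *)

Set Implicit Arguments.
Unset Strict Implicit.
Unset Printing Implicit Defensive.
Import Order.TTheory GRing.Theory Num.Theory.
Import numFieldNormedType.Exports.
Local Open Scope ring_scope.

(** * Calculus and connections *)

(* The laws of the matrix product, restated over a realType:
   the instances inferred by the general laws follow other coercion paths, and
   equal products would no longer be syntactically equal. *)
Section MatrixLaws.
Context {R : realType} {a b c d : nat}.
Implicit Types (A B : 'M[R]_(a, b)) (C D : 'M[R]_(b, c)) (E : 'M[R]_(c, d)).

Lemma mxDl A B C : (A + B) *m C = A *m C + B *m C.
Proof. exact: mulmxDl. Qed.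
Lemma mxDr A C D : A *m (C + D) = A *m C + A *m D.
Proof. exact: mulmxDr. Qed.
Lemma mxNl A C : (- A) *m C = - (A *m C).
Proof. exact: mulNmx. Qed.
Lemma mxNr A C : A *m (- C) = - (A *m C).
Proof. exact: mulmxN. Qed.
Lemma mxA A C E : A *m (C *m E) = A *m C *m E.
Proof. exact: mulmxA. Qed.
Lemma mx0l C : (0 : 'M[R]_(a, b)) *m C = 0.
Proof. exact: mul0mx. Qed.
Lemma mx0r A : A *m (0 : 'M[R]_(b, c)) = 0.
Proof. exact: mulmx0. Qed.
Lemma mxtrM A C : (A *m C)^T = C^T *m A^T.
Proof. exact: trmx_mul. Qed.
Lemma mxtrD A B : (A + B)^T = A^T + B^T.
Proof. exact: linearD. Qed.
Lemma mxtrN A : (- A)^T = - A^T.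
Proof. exact: linearN. Qed.

End MatrixLaws.

(** Aimed at identities valid in any noncommutative ring with transposition: products are expanded
    and frozen as atoms, so that [ring] only meets sums of entries. *)
Ltac mx_abel :=
  rewrite ?(mxtrM, mxtrD, mxtrN, trmxK, mxDl, mxDr, mxNl, mxNr, mx0l, mx0r, mxA);
  try reflexivity;
  repeat match goal with
  |- context [@mulmx ?S ?a ?b ?c ?A ?B] => generalize (@mulmx S a b c A B); intro end;
  apply/matrixP => ? ?; rewrite ?mxE; ring.

(* The rules of calculus satisfied by the matrix-valued functions that are
   smooth on an open set; the derivation is abstract, so that conversion never
   unfolds it into a limit. *)
Record diff_calculus (R : realType) (X E : Type) := DiffCalculus {
  dom :> X -> Prop ;
  smooth : forall a b, (X -> 'M[R]_(a, b)) -> Prop ;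
  der : forall a b, E -> (X -> 'M[R]_(a, b)) -> X -> 'M[R]_(a, b) ;
  smooth_eq : forall a b (A B : X -> 'M[R]_(a, b)),
    (forall q, dom q -> A q = B q) -> smooth A -> smooth B ;
  smooth_cst : forall a b (M : 'M[R]_(a, b)), smooth (fun=> M) ;
  smooth_add : forall a b (A B : X -> 'M[R]_(a, b)),
    smooth A -> smooth B -> smooth (fun q => A q + B q) ;
  smooth_sub : forall a b (A B : X -> 'M[R]_(a, b)),
    smooth A -> smooth B -> smooth (fun q => A q - B q) ;
  smooth_mul : forall a b c (A : X -> 'M[R]_(a, b)) (B : X -> 'M[R]_(b, c)),
    smooth A -> smooth B -> smooth (fun q => A q *m B q) ;
  smooth_tr : forall a b (A : X -> 'M[R]_(a, b)),
    smooth A -> smooth (fun q => (A q)^T) ;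
  smooth_inv : forall a (A : X -> 'M[R]_a), smooth A ->
    (forall q, dom q -> A q \in unitmx) -> smooth (fun q => invmx (A q)) ;
  smooth_der : forall a b (A : X -> 'M[R]_(a, b)) u, smooth A -> smooth (der u A) ;
  der_eq : forall a b (A B : X -> 'M[R]_(a, b)) u p, dom p ->
    (forall q, dom q -> A q = B q) -> der u A p = der u B p ;
  der_cst : forall a b (M : 'M[R]_(a, b)) u p, der u (fun=> M) p = 0 ;
  der_add : forall a b (A B : X -> 'M[R]_(a, b)) u p, dom p ->
    smooth A -> smooth B -> der u (fun q => A q + B q) p = der u A p + der u B p ;
  der_sub : forall a b (A B : X -> 'M[R]_(a, b)) u p, dom p ->
    smooth A -> smooth B -> der u (fun q => A q - B q) p = der u A p - der u B p ;
  der_mul : forall a b c (A : X -> 'M[R]_(a, b)) (B : X -> 'M[R]_(b, c)) u p,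
    dom p -> smooth A -> smooth B ->
    der u (fun q => A q *m B q) p = der u A p *m B p + A p *m der u B p ;
  der_tr : forall a b (A : X -> 'M[R]_(a, b)) u p, dom p ->
    smooth A -> der u (fun q => (A q)^T) p = (der u A p)^T ;
  der_comm : forall a b (A : X -> 'M[R]_(a, b)) u v p, dom p ->
    smooth A -> der u (der v A) p = der v (der u A) p
}.

Section Connection.
Context {R : realType} {X E : Type} {n : nat} {U : diff_calculus R X E}.
Implicit Types (u v w : E) (p q : X).
Local Notation D := (@der _ _ _ U _ _).
Local Notation sm := (@smooth _ _ _ U _ _).
Variable Om : E -> X -> 'M[R]_n.
Hypothesis sOm : forall u, sm (Om u).

(* The definitions are locked: otherwise the distributivity laws would match
   their unfoldings. *)
Definition covd a u (xi : X -> 'M[R]_(a, n)) p : 'M[R]_(a, n) :=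
  locked (D u xi p + xi p *m Om u p).

(* In the row vector convention xi *m curv u v is
   nabla_u nabla_v xi - nabla_v nabla_u xi. *)
Definition curv u v p : 'M[R]_n :=
  locked (D u (Om v) p - D v (Om u) p + Om v p *m Om u p - Om u p *m Om v p).

Lemma covdE a u (xi : X -> 'M[R]_(a, n)) p : covd u xi p = D u xi p + xi p *m Om u p.
Proof. by rewrite /covd -lock. Qed.

Lemma curvE u v p :
  curv u v p = D u (Om v) p - D v (Om u) p + Om v p *m Om u p - Om u p *m Om v p.
Proof. by rewrite /curv -lock. Qed.

Lemma smooth_covd a u (xi : X -> 'M[R]_(a, n)) : sm xi -> sm (covd u xi).
Proof.
move=> s; apply: (@smooth_eq _ _ _ _ _ _ (fun p => D u xi p + xi p *m Om u p)).
  by move=> p _; rewrite covdE.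
by apply: smooth_add; [exact: smooth_der|exact: smooth_mul].
Qed.

Lemma covd_add a u (xi eta : X -> 'M[R]_(a, n)) p : U p -> sm xi -> sm eta ->
  covd u (fun q => xi q + eta q) p = covd u xi p + covd u eta p.
Proof. by move=> Up sx se; rewrite !covdE der_add//; mx_abel. Qed.

Lemma covd_mul a b u (A : X -> 'M[R]_(a, b)) (xi : X -> 'M[R]_(b, n)) p :
  U p -> sm A -> sm xi ->
  covd u (fun q => A q *m xi q) p = D u A p *m xi p + A p *m covd u xi p.
Proof. by move=> Up sA sx; rewrite !covdE der_mul//; mx_abel. Qed.

Lemma covd_mull a b u (A : 'M[R]_(a, b)) (xi : X -> 'M[R]_(b, n)) p :
  U p -> sm xi -> covd u (fun q => A *m xi q) p = A *m covd u xi p.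
Proof.
move=> Up sx; rewrite (@covd_mul a b u (fun=> A))//; last exact: smooth_cst.
by rewrite der_cst mul0mx add0r.
Qed.

Lemma smooth_sum a b (I : Type) (r : seq I) (A : I -> X -> 'M[R]_(a, b)) :
  (forall i, sm (A i)) -> sm (fun q => \sum_(i <- r) A i q).
Proof.
move=> sA; elim: r => [|i r IH].
  apply: (@smooth_eq _ _ _ _ _ _ (fun=> 0)); last exact: smooth_cst.
  by move=> q _; rewrite big_nil.
apply: (@smooth_eq _ _ _ _ _ _ (fun q => A i q + \sum_(i <- r) A i q)).
  by move=> q _; rewrite big_cons.
exact: smooth_add.
Qed.

Lemma covd_eq a u (xi eta : X -> 'M[R]_(a, n)) p : U p ->
  (forall q, U q -> xi q = eta q) -> covd u xi p = covd u eta p.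
Proof. by move=> Up xe; rewrite !covdE (der_eq _ Up xe) xe. Qed.

Lemma covd_sum a u (I : Type) (r : seq I) (A : I -> X -> 'M[R]_(a, n)) p : U p ->
  (forall i, sm (A i)) ->
  covd u (fun q => \sum_(i <- r) A i q) p = \sum_(i <- r) covd u (A i) p.
Proof.
move=> Up sA; elim: r => [|i r IH].
  rewrite big_nil (covd_eq (eta := fun=> 0) u Up); last by move=> q _; rewrite big_nil.
  by rewrite covdE der_cst mx0l addr0.
rewrite big_cons -IH -covd_add//; last exact: smooth_sum.
by apply: covd_eq => // q _; rewrite big_cons.
Qed.

(** The directions are constant, so no bracket term occurs; the second derivatives of [xi] cancel by
    [der_comm] and the first-order terms are symmetric in [u] and [v]. *)
Lemma covd_comm a u v (xi : X -> 'M[R]_(a, n)) p : U p -> sm xi ->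
  covd u (covd v xi) p - covd v (covd u xi) p = xi p *m curv u v p.
Proof.
move=> Up sx; have sx' w : sm (D w xi) by exact: smooth_der.
have cE a' b' : covd a' (covd b' xi) p =
    D a' (D b' xi) p + (D a' xi p *m Om b' p + xi p *m D a' (Om b') p)
    + (D b' xi p + xi p *m Om b' p) *m Om a' p.
  rewrite covdE (der_eq (B := fun q => D b' xi q + xi q *m Om b' q) a' Up); last first.
    by move=> q _; rewrite covdE.
  by rewrite covdE der_add ?der_mul//; exact: smooth_mul.
by rewrite !cE curvE (der_comm u v Up sx); mx_abel.
Qed.

Lemma curvC u v p : curv v u p = - curv u v p.
Proof. by rewrite !curvE; mx_abel. Qed.

(** Equating the two mixed second derivatives of [g], both computed from metric compatibility, gives
    exactly this identity. *)
Lemma curv_skew (g : X -> 'M[R]_n) u v p : sm g ->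
  (forall w q, U q -> D w g q = Om w q *m g q + g q *m (Om w q)^T) -> U p ->
  curv u v p *m g p + g p *m (curv u v p)^T = 0.
Proof.
move=> sg Dg Up.
have sT w := smooth_tr (sOm w).
have DD a b : D a (D b g) p = D a (Om b) p *m g p + Om b p *m (Om a p *m g p + g p *m (Om a p)^T)
   + ((Om a p *m g p + g p *m (Om a p)^T) *m (Om b p)^T + g p *m (D a (Om b) p)^T).
  rewrite (der_eq a Up (Dg b)) der_add ?der_mul ?der_tr ?Dg//; exact: smooth_mul.
have := der_comm u v Up sg; rewrite !DD => /eqP; rewrite -subr_eq0 => /eqP <-.
by rewrite !curvE; mx_abel.
Qed.

Lemma curv_comm (J : 'M[R]_n) u v p : U p ->
  (forall w q, U q -> J *m Om w q = Om w q *m J) ->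
  J *m curv u v p = curv u v p *m J.
Proof.
move=> Up HJ.
have DJ a b : J *m D a (Om b) p = D a (Om b) p *m J.
  have e1 : D a (fun q => J *m Om b q) p = J *m D a (Om b) p.
    by rewrite (@der_mul _ _ _ U _ _ _ (fun=> J)) ?der_cst ?mul0mx ?add0r//; exact: smooth_cst.
  have e2 : D a (fun q => Om b q *m J) p = D a (Om b) p *m J.
    rewrite (@der_mul _ _ _ U _ _ _ (Om b) (fun=> J)) ?der_cst ?mulmx0 ?addr0//.
    exact: smooth_cst.
  by rewrite -e1 -e2; apply: der_eq => // q Uq; exact: HJ.
rewrite !curvE !(mulmxDl, mulmxDr, mulmxBl, mulmxBr, mulNmx, mulmxN) !DJ.
by rewrite !mulmxA !HJ// -!mulmxA !HJ// !mulmxA.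
Qed.

End Connection.
Arguments covd {R X E n} U Om {a} u xi p.
Arguments curv {R X E n} U Om u v p.

Section Bianchi.
Context {R : realType} {X : Type} {m n : nat} {U : diff_calculus R X 'rV[R]_m}.
Local Notation D := (@der _ _ _ U _ _).
Local Notation sm := (@smooth _ _ _ U _ _).
Variables (Om : 'rV[R]_m -> X -> 'M[R]_n) (T : X -> 'M[R]_(m, n)).
Hypotheses (sOm : forall u, sm (Om u)) (sT : sm T).
Hypothesis torsion_free : forall u v q, U q ->
  v *m covd U Om u T q = u *m covd U Om v T q.

(** Each curvature term is a commutator of covariant derivatives of [T]. Torsion-freeness turns
    nabla_a nabla_b (T c) into nabla_a nabla_c (T b), and the six terms cancel in pairs. *)
Lemma bianchi u v w p : U p ->
  w *m T p *m curv U Om u v p + u *m T p *m curv U Om v w p + v *m T p *m curv U Om w u p = 0.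
Proof.
move=> Up.
have E a b c : c *m T p *m curv U Om a b p =
    covd U Om a (fun q => c *m covd U Om b T q) p - covd U Om b (fun q => c *m covd U Om a T q) p.
  have sc d : sm (covd U Om d T) by exact: smooth_covd.
  by rewrite -mxA -covd_comm// (covd_mull Om a c Up (sc b)) (covd_mull Om b c Up (sc a)); mx_abel.
have C a b c : covd U Om a (fun q => c *m covd U Om b T q) p
    = covd U Om a (fun q => b *m covd U Om c T q) p.
  by apply: covd_eq => // q Uq; exact: torsion_free.
by rewrite !E (C u v w) (C v w u) (C w u v); mx_abel.
Qed.

End Bianchi.

(** * Curvature of complex space forms *)

Section HolomorphicPolarization.
Context {R : realType} {E : zmodType}.
Variables (J : {additive E -> E}) (B : E -> E -> E -> E -> R).
Hypotheses (JJ : forall x, J (J x) = - x).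
Hypotheses (BD1 : forall x x' y z w, B (x + x') y z w = B x y z w + B x' y z w)
  (BC12 : forall x y z w, B y x z w = - B x y z w)
  (BC34 : forall x y z w, B x y w z = - B x y z w)
  (Bbianchi : forall x y z w, B x y z w + B y z x w + B z x y w = 0)
  (BJ : forall x y z w, B x y (J z) (J w) = B x y z w)
  (Bhol : forall x, B x (J x) (J x) x = 0).

(** The classical combination of the four Bianchi identities got by rotating the arguments; the
    antisymmetries reduce their terms to common ones. *)
Let Bpair x y z w : B x y z w = B z w x y.
Proof.
have := Bbianchi x y z w; have := Bbianchi y z w x.
have := Bbianchi z w x y; have := Bbianchi w x y z.
have := BC34 x y z w; have := BC12 x y z w; have := BC12 z w x y; have := BC34 z w x y.
have := BC34 y z x w; have := BC12 y z x w; have := BC12 x w y z; have := BC34 x w y z.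
have := BC34 z x y w; have := BC12 z x y w; have := BC12 y w z x; have := BC34 y w z x.
have := BC34 x z y w; have := BC12 w y x z; have := BC34 w y x z.
have := BC34 w x y z; have := BC12 w x z y.
have := BC34 z y w x.
lra.
Qed.

Let BD2 x y y' z w : B x (y + y') z w = B x y z w + B x y' z w.
Proof. by rewrite BC12 BD1 opprD -!BC12. Qed.
Let BD3 x y z z' w : B x y (z + z') w = B x y z w + B x y z' w.
Proof. by rewrite Bpair BD1 -!(Bpair x y). Qed.
Let BD4 x y z w w' : B x y z (w + w') = B x y z w + B x y z w'.
Proof. by rewrite BC34 BD3 opprD -!BC34. Qed.
Let B0 y z w : B 0 y z w = 0.
Proof. by have := BD1 0 0 y z w; rewrite addr0; lra. Qed.
Let BN1 x y z w : B (- x) y z w = - B x y z w.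
Proof. by have := BD1 x (- x) y z w; rewrite subrr B0; lra. Qed.
Let BN2 x y z w : B x (- y) z w = - B x y z w.
Proof. by rewrite BC12 BN1 -BC12. Qed.
Let BN3 x y z w : B x y (- z) w = - B x y z w.
Proof. by rewrite Bpair BN1 -Bpair. Qed.
Let BN4 x y z w : B x y z (- w) = - B x y z w.
Proof. by rewrite BC34 BN3 -BC34. Qed.
Let BJl x y z w : B (J x) (J y) z w = B x y z w.
Proof. by rewrite Bpair BJ -Bpair. Qed.

(* The part of bidegree (2, 2) of the quartic form B(x, Jx, Jx, x). *)
Let hol22 x y : B x (J x) y (J y) + 2 * B x (J y) x (J y) = 0.
Proof.
have Q v : B v (J v) v (J v) = 0 by rewrite BC34 Bhol oppr0.
have := Q (x + y); have := Q (x - y); have := Q x; have := Q y.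
rewrite !(raddfD, raddfN) !(BD1, BD2, BD3, BD4, BN1, BN2, BN3, BN4).
have e1 : B y (J y) x (J x) = B x (J x) y (J y) by rewrite Bpair.
have e2 : B y (J x) y (J x) = B x (J y) x (J y).
  by rewrite -BJl -[in LHS]BJ !JJ BN2 BN4 BC12 BC34 !opprK.
have e3 : B y (J x) x (J y) = B x (J y) x (J y) by rewrite -BJl JJ BN2 BC12 opprK.
have e4 : B x (J y) y (J x) = B x (J y) x (J y) by rewrite -BJ JJ BN4 BC34 opprK.
rewrite e1 e2 e3 e4.
lra.
Qed.

(** Bianchi and [hol22] kill all sectional curvatures, and a curvature tensor without sectional
    curvature is zero. *)
Lemma kaehler_curvature_eq0 x y z w : B x y z w = 0.
Proof.
have sec u v : B u v u v = 0.
  (* For t = v and t = J v these are two independent linear equations, 3 a + b = 0 and a + 3 b = 0,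
     between the sectional curvatures of (u, J v) and (u, v). *)
  have b13 s t : 3 * B s (J t) s (J t) + B s t s t = 0.
    have := Bbianchi s (J s) t (J t); have := hol22 s t.
    have -> : B (J s) t s (J t) = - B s (J t) s (J t).
      by rewrite -BJl JJ BN1.
    have -> : B t s (J s) (J t) = - B s t s t by rewrite BJ BC12.
    lra.
  have := b13 u v; have := b13 u (J v); rewrite JJ BN2 BN4; lra.
have sec2 u v t : B u v u t = 0.
  have := sec u (v + t); rewrite !(BD2, BD4) !sec (Bpair u t u v); lra.
have alt u v t s : B u v t s = - B t v u s.
  have := sec2 (u + t) v s; rewrite !(BD1, BD3) !sec2; lra.
(* Now [B] alternates in its first three arguments, so the Bianchi sum is 3 B. *)
have := Bbianchi x y z w; rewrite (alt z x y w) (BC12 x y z w).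
have := alt x y z w; rewrite (BC12 y z x w); lra.
Qed.

End HolomorphicPolarization.

Section ComplexSpaceForm.
Context {R : realType} {E : zmodType}.
Variables (J : {additive E -> E}) (b : E -> E -> R).
Hypotheses (JJ : forall x, J (J x) = - x).
Hypotheses (bD : forall x x' y, b (x + x') y = b x y + b x' y)
  (bC : forall x y, b x y = b y x) (bJ : forall x y, b (J x) (J y) = b x y).

(** The curvature tensor of a Kaehler metric of holomorphic sectional curvature 4, paired with
    [w]. *)
Definition space_form x y z w : R :=
  b y z * b x w - b x z * b y w + b (J y) z * b (J x) w - b (J x) z * b (J y) w
    + 2 * (b x (J y) * b (J z) w).

Let bJl x y : b (J x) y = - b x (J y).
Proof.
have b0 v : b 0 v = 0 by have := bD 0 0 v; rewrite addr0; lra.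
have bN u v : b (- u) v = - b u v by have := bD u (- u) v; rewrite subrr b0; lra.
by rewrite -[in LHS]bJ JJ bN.
Qed.

(** The difference between [K] and the model has all the symmetries of a Kaehler curvature tensor
    and no holomorphic sectional curvature, so it vanishes. *)
Lemma holomorphic_curvature (K : E -> E -> E -> E -> R) (c : R) :
  (forall x x' y z w, K (x + x') y z w = K x y z w + K x' y z w) ->
  (forall x y z w, K y x z w = - K x y z w) ->
  (forall x y z w, K x y w z = - K x y z w) ->
  (forall x y z w, K x y z w + K y z x w + K z x y w = 0) ->
  (forall x y z w, K x y (J z) (J w) = K x y z w) ->
  (forall x, K x (J x) (J x) x = 4 * c * b x x ^+ 2) ->
  forall x y z w, K x y z w = c * space_form x y z w.
Proof.
move=> KD KC12 KC34 Kb KJ Kh x y z w; apply/eqP; rewrite -subr_eq0; apply/eqP.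
have b0 v : b 0 v = 0 by have := bD 0 0 v; rewrite addr0; lra.
have bNl u v : b (- u) v = - b u v by have := bD u (- u) v; rewrite subrr b0; lra.
have bNr u v : b u (- v) = - b u v by rewrite bC bNl bC.
apply: (@kaehler_curvature_eq0 R E J (fun x y z w => K x y z w - c * space_form x y z w));
  rewrite /space_form //; clear x y z w.
- by move=> x x' y z w; rewrite KD !raddfD !bD; ring.
- move=> x y z w; have e : b y (J x) = - b x (J y) by rewrite bC bJl.
  by rewrite KC12 e; ring.
- move=> x y z w; have e : b (J w) z = - b (J z) w by rewrite bJl bC.
  by rewrite KC34 e; ring.
- move=> x y z w; have := Kb x y z w => /eqP; rewrite addr_eq0 => /eqP Kz.
  have ez : b z (J x) = - b x (J z) by rewrite bC bJl.
  have ey : b y (J x) = - b x (J y) by rewrite bC bJl.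
  have ew : b z (J y) = - b y (J z) by rewrite bC bJl.
  rewrite !bJl ez ey ew (bC z x) (bC z y) (bC y x).
  have -> : K z x y w = - (K x y z w + K y z x w) by rewrite Kz opprK.
  ring.
- by move=> x y z w; rewrite KJ !bJ !bJl; ring.
- move=> x; rewrite Kh !JJ !(bNl, bNr) !bJ.
  have -> : b (J x) x = 0 by have := bJl x x; rewrite bC; lra.
  by ring.
Qed.

End ComplexSpaceForm.

(** * Pointwise algebra of semi-parallel CR-submanifolds *)

(* A and E are the tangent spaces of the submanifold and of the ambient space,
   T is the differential of the immersion, P the tangential part of J, h the
   second fundamental form and S V x the shape operator A_V x.  The hypothesis
   semi_par is the semi-parallelity condition paired with V, after substitution
   of the equations of Gauss and Ricci. *)
Section SemiParallelPointwise.
Context {R : realType} {A E : lmodType R}.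
Variables (J : {linear E -> E}) (b : E -> E -> R) (T : {linear A -> E}).
Variables (P : {linear A -> A}) (h : A -> A -> E) (S : E -> A -> A) (c : R).
Hypotheses (JJ : forall x, J (J x) = - x)
  (bD : forall x x' y, b (x + x') y = b x y + b x' y)
  (bZ : forall k x y, b (k *: x) y = k * b x y)
  (bC : forall x y, b x y = b y x) (b_gt0 : forall x, x != 0 -> 0 < b x x)
  (bJ : forall x y, b (J x) (J y) = b x y).
Hypothesis T_inj : injective T.
Hypotheses (PT : forall x y, b (T (P x)) (T y) = b (J (T x)) (T y))
  (CR : forall x, J (T (P x)) = T (P (P x))).
Hypotheses (hD : forall x y y', h x (y + y') = h x y + h x y')
  (hZ : forall k x y, h x (k *: y) = k *: h x y)
  (hC : forall x y, h x y = h y x) (hn : forall x y z, b (h x y) (T z) = 0).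
Hypothesis ShE : forall V x y, b (T (S V x)) (T y) = b V (h x y).

Local Notation a x y := (b (T x) (T y)).
Local Notation normal V := (forall z, b V (T z) = 0).
Local Notation holo x := (P (P x) = - x).
Local Notation orth x := (P x = 0).
Local Notation K := (space_form J b).

Hypothesis c0 : c != 0.
Hypothesis semi_par : forall x y z w V, normal V ->
  c * K (T x) (T y) (h z w) V
    + a (S V x) (S (h z w) y) - a (S V y) (S (h z w) x)
  = (c * K (T x) (T y) (T z) (T (S V w))
      + b (h y z) (h x (S V w)) - b (h x z) (h y (S V w)))
  + (c * K (T x) (T y) (T w) (T (S V z))
      + b (h y w) (h x (S V z)) - b (h x w) (h y (S V z))).
Hypothesis holo_dim : forall z, exists x,
  [/\ holo x, 0 < a x x, a x z = 0 & a (P x) z = 0].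

Let bD2 x y y' : b x (y + y') = b x y + b x y'.
Proof. by rewrite bC bD !(bC x). Qed.
Let bZ2 k x y : b x (k *: y) = k * b x y.
Proof. by rewrite bC bZ bC. Qed.
Let bN x y : b (- x) y = - b x y.
Proof. by rewrite -scaleN1r bZ mulN1r. Qed.
Let bN2 x y : b x (- y) = - b x y.
Proof. by rewrite bC bN bC. Qed.
Let b0 x : b 0 x = 0.
Proof. by rewrite -(scale0r 0) bZ mul0r. Qed.
Let b02 x : b x 0 = 0.
Proof. by rewrite bC b0. Qed.
Let bJl x y : b (J x) y = - b x (J y).
Proof. by rewrite -[in LHS]bJ JJ bN. Qed.
Let TZ k x : T (k *: x) = k *: T x. Proof. by rewrite linearZ. Qed.
Let hD1 x x' y : h (x + x') y = h x y + h x' y.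
Proof. by rewrite hC hD !(hC y). Qed.
Let hZ1 k x y : h (k *: x) y = k *: h x y.
Proof. by rewrite hC hZ hC. Qed.
Let h0 x : h x 0 = 0.
Proof. by rewrite -(scale0r 0) hZ scale0r. Qed.
Let hN x y : h x (- y) = - h x y.
Proof. by rewrite -scaleN1r hZ scaleN1r. Qed.

Lemma phiC x y : a (P x) y = - a (P y) x.
Proof. by rewrite !PT bJl bC. Qed.

Lemma phi0 x : a (P x) x = 0.
Proof. by have := phiC x x; lra. Qed.

Lemma phiPP x y : holo x -> a (P x) (P y) = a x y.
Proof. by move=> hx; rewrite bC phiC hx linearN bN opprK. Qed.

Lemma holoP x : holo x -> holo (P x).
Proof. by move=> hx; rewrite hx linearN. Qed.

Lemma JT_holo x : holo x -> J (T x) = T (P x).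
Proof.
by move=> hx; have := CR (P x); rewrite hx !linearN => /oppr_inj. Qed.

Lemma JT_orth x : orth x -> normal (J (T x)).
Proof. by move=> hx z; rewrite -PT hx (linear0 T) b0. Qed.

(* Summing the semi-parallelity condition cyclically over x, y, z cancels the
   terms that are cubic in h, as well as the first Bianchi sum. *)
Lemma semi_parallel_cyclic x y z w V : normal V ->
  let t x y z := b (J (T y)) (h z w) * b (J (T x)) V - b (J (T x)) (h z w) * b (J (T y)) V
    + 2 * a (P y) x * (b (J (h z w)) V - b (h z (P w)) V)
    - a (P y) w * b (h z (P x)) V + a (P x) w * b (h z (P y)) V in
  t x y z + t y z x + t z x y = 0.
Proof.
move=> nV t.
have SE X Y : b (h X Y) V = a (S V X) Y by rewrite ShE bC.
have nV' X : b (T X) V = 0 by rewrite bC nV.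
(* Once every term cubic in [h] is written with two shape operators, the cyclic sum of these terms
   cancels formally. *)
have quad X Y Z W : b (h X Y) (h Z (S V W)) = a (S V W) (S (h X Y) Z).
  by rewrite [RHS]bC ShE.
have JS X Y : b (J (T X)) (T Y) = a (P X) Y by rewrite PT.
have JJT X Y : b (T X) (J (T Y)) = a (P Y) X by rewrite bC PT.
have SVC X Y : a (S V X) Y = a (S V Y) X by rewrite !ShE hC.
have := semi_par x y z w nV; have := semi_par y z x w nV; have := semi_par z x y w nV.
rewrite /space_form !quad !(hn, nV', bC (T _) (h _ _)) (hC y x) (hC z y) (hC z x) !JJT !JS.
rewrite !(bC (T _) (T (S V _))) => e3 e2 e1.
have sum3 (u1 v1 u2 v2 u3 v3 r : R) : u1 = v1 -> u2 = v2 -> u3 = v3 ->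
    r = (u1 - v1) + (u2 - v2) + (u3 - v3) -> r = 0.
  by move=> -> -> -> ->; ring.
(* Only terms carrying the factor c survive, so c can be divided out. *)
apply: (mulfI c0); rewrite mulr0; apply: (sum3 _ _ _ _ _ _ _ e1 e2 e3).
rewrite /t !SE (phiC z y) (phiC y x) (phiC x z) (SVC y x) (SVC z x) (SVC z y).
by rewrite (bC (T y) (T x)) (bC (T z) (T x)) (bC (T z) (T y)); ring.
Qed.

(** * The component of h in a normal direction J U with U in D' *)

Section OneNormal.
Variable u : A.
Let f x y := b (h x y) (J (T u)).
Hypothesis ou : orth u.

Let nJu : normal (J (T u)). Proof. exact: JT_orth. Qed.
Let fC x y : f x y = f y x. Proof. by rewrite /f hC. Qed.
Let fD x y y' : f x (y + y') = f x y + f x y'. Proof. by rewrite /f hD bD. Qed.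
Let fZ k x y : f x (k *: y) = k * f x y. Proof. by rewrite /f hZ bZ. Qed.
Let fN x y : f x (- y) = - f x y. Proof. by rewrite /f hN bN. Qed.
Let f0 x : f x 0 = 0. Proof. by rewrite /f h0 b0. Qed.
Let Jhf x y : b (J (h x y)) (J (T u)) = 0. Proof. by rewrite bJ hn. Qed.

Let JhT x y z : holo x -> b (J (T x)) (h y z) = 0.
Proof. by move=> hx; rewrite JT_holo// bC hn. Qed.

Let JhTu x : holo x -> b (J (T x)) (J (T u)) = 0.
Proof. by move=> hx; rewrite JT_holo// bC nJu. Qed.

(* The cyclic identity on the holomorphic distribution, for y = P x. *)
Let cyc_holo x z w : holo x -> holo z -> a x z = 0 -> a (P x) z = 0 -> holo w ->
  2 * a x x * f z (P w) + a x w * f z (P x) - a (P x) w * f z x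
   + a (P z) w * f x x - a x w * f x (P z) - a (P x) w * f (P x) (P z)
   + a (P z) w * f (P x) (P x) = 0.
Proof.
move=> hx hz xz Pxz hw; have hPx := holoP hx.
have := semi_parallel_cyclic x (P x) z w nJu.
rewrite /= !JhT// !Jhf -!/(f _ _) !hx !fN !linearN !bN Pxz.
have -> : a (P z) (P x) = 0 by rewrite phiPP// bC.
by move=> <-; ring.
Qed.

Let fD1 x x' y : f (x + x') y = f x y + f x' y.
Proof. by rewrite fC fD !(fC y). Qed.
Let fZ1 k x y : f (k *: x) y = k * f x y.
Proof. by rewrite fC fZ fC. Qed.

(** Take w = z and x orthogonal to the complex line of z: a single term of the cyclic identity
    survives. Polarized in [f_PC], this says that f is J-invariant on D. *)
Let f_P z : holo z -> f z (P z) = 0.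
Proof.
move=> hz; have [x [hx x0 xz Pxz]] := holo_dim z.
have := cyc_holo hx hz xz Pxz hz; rewrite xz Pxz phi0.
move=> e; apply: (mulfI (x := 2 * a x x)); first by rewrite mulf_neq0// ?gt_eqF// pnatr_eq0.
by rewrite mulr0 -e; ring.
Qed.

Let f_PC z w : holo z -> holo w -> f z (P w) = - f w (P z).
Proof.
move=> hz hw; have hzw : holo (z + w) by rewrite !linearD hz hw.
have := f_P hzw; rewrite linearD !(fD, fD1) !f_P//.
by rewrite add0r addr0 addrC => /eqP; rewrite addr_eq0 => /eqP.
Qed.

(** This is the choice w = P z. With [f_orthP] and [f_orth0], which rest on w = x, it compares f on
    two orthogonal complex lines. *)
Let f_diag x z : holo x -> holo z -> 0 < a x x -> a x z = 0 -> a (P x) z = 0 ->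
  a x x * f z z = a z z * f x x.
Proof.
move=> hx hz x0 xz Pxz; have := cyc_holo hx hz xz Pxz (holoP hz).
rewrite hz fN !phiPP// xz (f_PC (holoP hx) hx) hx fN opprK.
have -> : a x (P z) = 0 by rewrite bC phiC Pxz oppr0.
lra.
Qed.

Let f_orthP x z : holo x -> holo z -> 0 < a x x -> a x z = 0 -> a (P x) z = 0 ->
  f z (P x) = 0.
Proof.
move=> hx hz x0 xz Pxz; have := cyc_holo hx hz xz Pxz hx.
rewrite phi0 phiC Pxz (f_PC hx hz) => e.
apply: (mulfI (x := 4 * a x x)); first by rewrite mulf_neq0// ?gt_eqF// pnatr_eq0.
by rewrite mulr0 -e; ring.
Qed.

Let f_orth0 x z : holo x -> holo z -> 0 < a x x -> a x z = 0 -> a (P x) z = 0 ->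
  f z x = 0.
Proof.
move=> hx hz x0 xz Pxz; have := @f_orthP (P x) z (holoP hx) hz.
rewrite phiPP// hx fN linearN bN xz oppr0 => /(_ x0 Pxz erefl)/eqP.
by rewrite oppr_eq0 => /eqP.
Qed.

Let f_sq x z : holo x -> 0 < a x x -> holo z -> a x x * f z z = a z z * f x x.
Proof.
move=> hx x0 hz; set s := a x x in x0 *; have s0 : s != 0 by rewrite gt_eqF.
(* Coordinates of z in the complex line of x; the remainder [z1] is orthogonal to that line, where
   the preceding lemmas apply. *)
pose al := a x z / s; pose be := a (P x) z / s.
pose z1 := z - (al *: x + be *: P x).
have zE : z = z1 + (al *: x + be *: P x) by rewrite subrK.
have hPx := holoP hx.
have hz1 : holo z1.
  by rewrite /z1 !linearB !linearD !linearZ /= hz hPx hx linearN !scalerN -opprB opprK -opprD addrC.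
have aP : a (P x) x = 0 by exact: phi0.
have xz1 : a x z1 = 0.
  rewrite /z1 linearB linearD !linearZ /= bD2 bN2 bD2 !bZ2 (bC (T x) (T (P x))) aP mulr0 addr0.
  by rewrite -/s /al divfK// subrr.
have Pxz1 : a (P x) z1 = 0.
  rewrite /z1 linearB linearD !linearZ /= bD2 bN2 bD2 !bZ2 aP mulr0 add0r.
  by rewrite phiPP// -/s /be divfK// subrr.
clearbody z1 al be.
have fPP : f (P x) (P x) = f x x by rewrite f_PC// hx fN opprK.
have -> : f z z = f z1 z1 + (al ^+ 2 + be ^+ 2) * f x x.
  rewrite zE !(fD, fD1) !(fZ, fZ1) !(fC x z1) !(fC (P x)) fPP f_P//.
  by rewrite (f_orth0 hx hz1 x0 xz1 Pxz1) (f_orthP hx hz1 x0 xz1 Pxz1); ring.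
have -> : a z z = a z1 z1 + (al ^+ 2 + be ^+ 2) * s.
  rewrite zE !linearD !linearZ /= !(bD, bD2) !(bZ, bZ2) phiPP// (bC (T z1)) xz1.
  by rewrite (bC (T z1) (T (P x))) Pxz1 (bC (T x) (T (P x))) aP -/s; ring.
by rewrite mulrDr (f_diag hx hz1 x0 xz1 Pxz1); ring.
Qed.

(** Polarization of [f_sq]: D is umbilical in the direction J U. *)
Lemma second_form_holo x z w : holo x -> 0 < a x x -> holo z -> holo w ->
  a x x * b (h z w) (J (T u)) = a z w * b (h x x) (J (T u)).
Proof.
move=> hx x0 hz hw; rewrite -!/(f _ _).
have hzw : holo (z + w) by rewrite !linearD hz hw.
have := f_sq hx x0 hzw; have := f_sq hx x0 hz; have := f_sq hx x0 hw.
rewrite !(fD, fD1) linearD !(bD, bD2) (fC w z) (bC (T w) (T z)).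
move=> e1 e2 e3; have {}e3 : 2 * (a x x * f z w) = 2 * (a z w * f x x) by nra.
by move/(mulfI _): e3; apply; rewrite pnatr_eq0.
Qed.

Let f_mixed z w : orth z -> holo w -> f z (P w) = 0.
Proof.
move=> oz hw; have [x [hx x0 xw Pxw]] := holo_dim w; have hPx := holoP hx.
have := semi_parallel_cyclic x (P x) z w nJu.
rewrite /= !(JhT _ _ hx) !(JhT _ _ hPx) !Jhf !(JhTu hx) !(JhTu hPx) -!/(f _ _).
rewrite oz hx !fN !linearN !f0 !bN (linear0 T) !b0.
rewrite xw Pxw (phiC x z) oz (linear0 T) b0 => e.
apply: (mulfI (x := 2 * a x x)); first by rewrite mulf_neq0// ?gt_eqF// pnatr_eq0.
by rewrite mulr0 -e; ring.
Qed.

Lemma second_form_mixed_normal z w : orth z -> holo w -> b (h z w) (J (T u)) = 0.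
Proof.
move=> oz hw; have := f_mixed oz (holoP hw); rewrite hw fN => /eqP.
by rewrite oppr_eq0 => /eqP.
Qed.

End OneNormal.

(** Here V is an arbitrary normal vector, so the normal part of J h(z, w) vanishes; its tangential
    part is controlled by [second_form_mixed_normal]. *)
Lemma J_second_form_mixed z w V : holo z -> orth w -> normal V -> b (J (h z w)) V = 0.
Proof.
move=> hz ow nV; have [x [hx x0 xz Pxz]] := holo_dim z; have hPx := holoP hx.
have := semi_parallel_cyclic x (P x) z w nV.
have nT y : b (T y) V = 0 by rewrite bC nV.
have aw y : a (P y) w = 0 by rewrite phiC ow (linear0 T) b0 oppr0.
rewrite /= !(JT_holo hx) !(JT_holo hPx) !(JT_holo hz) !nT ow !h0 !b0 !aw hx linearN !bN.
have -> : a (P z) (P x) = 0 by rewrite phiPP// bC.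
rewrite Pxz => e.
apply: (mulfI (x := 2 * a x x)); first by rewrite mulf_neq0// ?gt_eqF// pnatr_eq0.
by apply: oppr_inj; rewrite mulr0 oppr0 -e; ring.
Qed.

Lemma J_second_form_orth z w V : orth z -> orth w -> normal V -> b (J (h z w)) V = 0.
Proof.
move=> oz ow nV; have [x [hx x0 _ _]] := holo_dim 0; have hPx := holoP hx.
have := semi_parallel_cyclic x (P x) z w nV.
have nT y : b (T y) V = 0 by rewrite bC nV.
have aw y : a (P y) w = 0 by rewrite phiC ow (linear0 T) b0 oppr0.
have az y : a (P y) z = 0 by rewrite phiC oz (linear0 T) b0 oppr0.
rewrite /= !(JT_holo hx) !(JT_holo hPx) !(bC (T _) (h _ _)) !hn !nT ow oz !h0 !b0 !aw hx.
rewrite (linear0 T) !b0 !az linearN !bN => e.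
apply: (mulfI (x := 2 * a x x)); first by rewrite mulf_neq0// ?gt_eqF// pnatr_eq0.
by apply: oppr_inj; rewrite mulr0 oppr0 -e; ring.
Qed.

(* Restated because space_form sees J as an additive map. *)
Let KE x y z w : K x y z w = b y z * b x w - b x z * b y w
  + b (J y) z * b (J x) w - b (J x) z * b (J y) w + 2 * (b x (J y) * b (J z) w).
Proof. by []. Qed.

Let b_eq0 x : b x x = 0 -> x = 0.
Proof. by move=> bx; apply/eqP/negP => /negP/b_gt0; rewrite bx ltxx. Qed.

Let a_inj x y : (forall z, a x z = a y z) -> x = y.
Proof.
move=> xy; apply: T_inj; apply/eqP; rewrite -subr_eq0; apply/eqP/b_eq0.
by rewrite -linearB linearB /= bD bN -linearB xy subrr.
Qed.

(** Applying J to [CR] gives P^3 = - P. Hence the image of P is D, and I + P^2 maps into D'. *)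
Lemma holo_image z : holo (P z).
Proof.
apply: T_inj; rewrite -CR; have := CR z => /(congr1 J).
by rewrite JJ => <-; rewrite linearN.
Qed.

Lemma orth_part z : orth (z + P (P z)).
Proof. by rewrite linearD /= holo_image subrr. Qed.

Let split z : z = (z + P (P z)) + P (- P z).
Proof. by rewrite linearN addrK. Qed.

(** J h(z, w) has no tangential part: against D because J D is tangent, against D' by
    [second_form_mixed_normal]. It has no normal part either. *)
Lemma second_form_mixed z w : holo z -> orth w -> h z w = 0.
Proof.
move=> hz ow; have nJ y : b (J (h z w)) (T y) = 0.
  rewrite (split y) linearD bD2 !bJl CR hn (hC z w).
  by rewrite second_form_mixed_normal ?oppr0 ?addr0//; exact: orth_part.
by apply: b_eq0; rewrite -bJ; apply: J_second_form_mixed.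
Qed.

(** [tan e] is the tangential part of [e], [dP u x] is (nabla_u P) x, and [C u v w V] is < (nabla_u
    h)(v, w), V >. *)
Variables (tan : E -> A) (dP : A -> A -> A) (C : A -> A -> A -> E -> R).
Hypothesis tanE : forall e y, a (tan e) y = b e (T y).
Hypothesis dPE : forall u x y, a (dP u x) y = b (J (h u x)) (T y) + b (J (T x)) (h u y).
Hypothesis codazzi : forall u v w V, normal V ->
  C u v w V - C v u w V = c * K (T u) (T v) (T w) V.
(* The derivative of the identity h (P x) (y + P (P y)) = 0. *)
Hypothesis mixed_derivative : forall u x y V, normal V ->
  C u (P x) (y + P (P y)) V + b (h (dP u x) (y + P (P y))) V
    + b (h (P x) (dP u (P y) + P (dP u y))) V = 0.
Hypothesis orth_dim : exists2 w, orth w & w != 0.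

Lemma semi_parallel_contradiction : False.
Proof.
have [x [hx s0 _ _]] := holo_dim 0; set s := a x x in s0.
have sn0 : s != 0 by rewrite gt_eqF.
(* The sign compensates < h, J y > = - < J h, y >; the factor makes L independent of the chosen x,
   by [second_form_holo]. *)
pose L := - s^-1 *: tan (J (h x x)).
have LE y : b (h x x) (J (T y)) = s * a L y.
  by rewrite /L linearZ bZ tanE bJl mulrNN mulVKf.
clearbody L.
have LP y : a L (P y) = 0.
  by apply: (mulfI sn0); rewrite mulr0 -LE CR hn.
have oL : orth L.
  by apply: a_inj => y; rewrite phiC bC LP oppr0 (linear0 T) b0.
have hL u v w : holo u -> holo v -> orth w -> b (h u v) (J (T w)) = a u v * a L w.
  move=> hu hv ow; apply: (mulfI sn0); rewrite (second_form_holo ow hx s0 hu hv).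
  by rewrite LE; ring.
(* Only two pieces of nabla P survive in [mixed_derivative], because h(D, D') = 0: the D'-part of
   (nabla_u P) v for v in D, and the D-part of (nabla_u P) w for w in D'. Both are determined by
   L. *)
have dP_orth u v : holo u -> holo v ->
    dP u v + P (P (dP u v)) = - a u v *: L.
  move=> hu hv; apply: a_inj => y; rewrite linearZ bZ.
  have o := orth_part y; have oQ := orth_part (dP u v).
  have -> : a (dP u v + P (P (dP u v))) y = a (dP u v) (y + P (P y)).
    rewrite !(linearD T) bD bD2; congr (_ + _).
    by rewrite phiC [RHS]bC [RHS]phiC bC.
  rewrite dPE bJl hL// (JT_holo hv) (bC (T (P v)) (h _ _)) hn addr0 (linearD T) bD2.
  by rewrite LP; ring.
have dP_holo u w v : holo u -> orth w -> holo v -> a (dP u w) v = a u v * a L w.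
  move=> hu ow hv; rewrite dPE second_form_mixed// (linear0 J) b0 add0r bC.
  by rewrite hL.
have dP0 u : dP u 0 = 0.
  by apply: a_inj => y; rewrite dPE h0 !linear0 !b0 addr0.
have Cmix u v w U : holo u -> holo v -> orth w -> orth U ->
    C u (P v) w (J (T U)) = a u v * (b (h L w) (J (T U)) - a L w * a L U).
  move=> hu hv ow oU; have := mixed_derivative u v w (JT_orth oU).
  have -> : w + P (P w) = w by rewrite ow linear0 addr0.
  rewrite ow dP0 add0r (hL _ _ _ (holo_image v) (holo_image (dP u w)) oU).
  have -> : a (P v) (P (dP u w)) = a u v * a L w.
    by rewrite phiPP// bC dP_holo.
  have -> : h (dP u v) w = - a u v *: h L w.
    rewrite (split (dP u v)) dP_orth// hD1 (second_form_mixed (holo_image _) ow).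
    by rewrite addr0 hZ1.
  by rewrite bZ => e; apply/eqP; rewrite -subr_eq0 -e; apply/eqP; ring.
have main w U : orth w -> orth U -> b (h L w) (J (T U)) = a L w * a L U - c * a w U.
  move=> ow oU; have nU := JT_orth oU; have hPx := holoP hx.
  have e1 := Cmix x x w U hx hx ow oU.
  (* [Cmix] needs its second argument in the form P v, and x = P (- P x). The two sides of the
     Codazzi equation at (x, P x) then add up, whence the factor 2 s below. *)
  have hNPx : holo (- P x) by rewrite !linearN hPx.
  have e2 := Cmix (P x) (- P x) w U hPx hNPx ow oU.
  have := codazzi x (P x) w nU.
  rewrite e1 (_ : C (P x) x w _ =
    - a (P x) (P x) * (b (h L w) (J (T U)) - a L w * a L U)); last first.
    by move: e2; rewrite (_ : P (- P x) = x) ?(linearN T) ?bN2// linearN hx opprK.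
  have nU' y : b (T y) (J (T U)) = 0 by rewrite bC nU.
  rewrite phiPP// KE (JT_holo hx) (JT_holo hPx) hx linearN !bN !bN2 !nU' bJ -/s => e.
  apply: (mulfI (x := 2 * s)); first by rewrite mulf_neq0// pnatr_eq0.
  by move: e; set B := b (h L w) _; move=> e; lra.
have [w0 ow0 w00] := orth_dim.
have aw0 : 0 < a w0 w0.
  apply: b_gt0; apply: contra w00 => /eqP; rewrite -[0](linear0 T).
  by move=> /T_inj ->.
set l := a L L.
have [L0|Ln0] := eqVneq L 0.
  have := main w0 w0 ow0 ow0; rewrite L0 hC h0 linear0 !b0 mul0r => /eqP.
  by rewrite sub0r eq_sym oppr_eq0 mulf_eq0 (negbTE c0) gt_eqF.
have l0 : 0 < l.
  apply: b_gt0; apply: contra Ln0 => /eqP; rewrite -[0](linear0 T).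
  by move=> /T_inj ->.
have nL := JT_orth oL.
have SL : S (J (T L)) L = (l - c) *: L.
  apply: a_inj => y; rewrite ShE linearZ bZ bC (split y) hD (hC L) (hC L).
  rewrite (second_form_mixed (holo_image _) oL) addr0 (linearD T) bD2 LP addr0.
  by rewrite (hC _ L) main ?orth_part// (bC (T (_ + _)) (T L)) -/l; ring.
have Sx : S (J (T L)) x = l *: x.
  apply: a_inj => y; rewrite ShE linearZ bZ bC (split y) hD bD (linearD T) bD2.
  rewrite (second_form_mixed hx (orth_part _)) b0 add0r hL ?holo_image// -/l.
  have -> : a x (y + P (P y)) = 0.
    rewrite -[x]opprK -hx (linearN T) bN phiC orth_part (linear0 T) b0 oppr0 oppr0 //.
  ring.
(* The eigenvalues l - c on L and l on x of the shape operator of J L differ by c. With B = < h(x,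
   x), h(L, L) >, the condition collapses to c (B + c l s) = 0. *)
have Gss : b (h x x) (h L L) = - (c * l * s).
  have := semi_par x L x L nL.
  have hxL : h x L = 0 by exact: second_form_mixed.
  have hLx : h L x = 0 by rewrite hC.
  have z1 V y w : a (S V y) (S (h x L) w) = 0 by rewrite bC ShE hxL b0.
  rewrite !z1 hLx hxL !b0 SL Sx !hZ !bZ2.
  have Lx : a L x = 0 by rewrite -[x]opprK -hx (linearN T) bN2 LP oppr0.
  have JxL : b (J (T x)) (T L) = 0 by rewrite JT_holo// bC LP.
  rewrite !KE !TZ !bZ2 !(linear0 J) !b0 !b02 nL JxL !nL -/l (bC (T x) (T L)) Lx -/s.
  rewrite (bC (T x) (J (T L))) nL => e.
  apply: (mulfI c0); move: e; set B := b (h x x) _; set B' := b (h L L) _.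
  have -> : B' = B by rewrite /B' bC.
  move=> e; lra.
have [t tE] : exists t, J (h L L) = T t.
  exists (tan (J (h L L))); apply/eqP; rewrite -subr_eq0; apply/eqP/b_eq0.
  have nt z : b (J (h L L) - T (tan (J (h L L)))) (T z) = 0.
    by rewrite bD bN tanE subrr.
  rewrite bD2 bN2 nt subr0 bC.
  exact: J_second_form_orth.
have Lt : a L t = - (l * l - c * l) by rewrite bC -tE bJl main.
(* Computed through J, the same product is s (l^2 - c l); compared with - c l s, this leaves s l^2 =
   0. *)
have := Gss; rewrite -bJ tE bJl LE Lt => e.
have : s * (l * l) = 0 by lra.
by apply/eqP; rewrite !mulf_neq0// gt_eqF.
Qed.

End SemiParallelPointwise.

(** * Submanifold equations *)

(* Turns inner products into variables, which ring then need not unfold when it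
   compares atoms. *)
Ltac ip_atoms := repeat match goal with
  |- context [@ip ?R ?m ?A ?x ?y] => generalize (@ip R m A x y); intro end.

Section InnerProduct.
Context {R : realType} {m : nat}.
Implicit Types (g : 'M[R]_m) (u v w : 'rV[R]_m).

Lemma ipDl g u v w : ip g (u + v) w = ip g u w + ip g v w.
Proof. by rewrite /ip !mxDl mxE. Qed.
Lemma ipDr g u v w : ip g w (u + v) = ip g w u + ip g w v.
Proof. by rewrite /ip mxtrD mxDr mxE. Qed.
Lemma ipNl g u w : ip g (- u) w = - ip g u w.
Proof. by rewrite /ip !mxNl mxE. Qed.
Lemma ipBl g u v w : ip g (u - v) w = ip g u w - ip g v w.
Proof. by rewrite ipDl ipNl. Qed.
Lemma ipZl g k u w : ip g (k *: u) w = k * ip g u w.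
Proof. by rewrite /ip -!scalemxAl mxE. Qed.
Lemma ipZr g k u w : ip g w (k *: u) = k * ip g w u.
Proof. by rewrite /ip linearZ /= -scalemxAr mxE. Qed.
Lemma ip0l g w : ip g 0 w = 0.
Proof. by rewrite /ip !mx0l mxE. Qed.
Lemma ipC g u v : g^T = g -> ip g u v = ip g v u.
Proof.
move=> gs; have e : v *m g *m u^T = (u *m g *m v^T)^T by rewrite !mxtrM trmxK gs mxA.
by rewrite /ip e [RHS]mxE.
Qed.

Lemma ip_unitmx g : (forall u, u != 0 -> 0 < ip g u u) -> g \in unitmx.
Proof.
move=> gp; rewrite -row_free_unit; apply: inj_row_free => u ug.
apply/eqP/negP => /negP/gp.
by rewrite /ip ug mul0mx mxE ltxx.
Qed.

Lemma bilinear_eq0_mx (a : nat) (A : 'M[R]_(a, m)) :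
  (forall (u : 'rV_a) (v : 'rV_m), (u *m A *m v^T) 0 0 = 0) -> A = 0.
Proof.
move=> A0; apply/matrixP => i j; rewrite mxE.
have := A0 (delta_mx 0 i) (delta_mx 0 j).
by rewrite -rowE trmx_delta -colE !mxE.
Qed.

Lemma mx_addE (a : nat) (A B : 'M[R]_(a, m)) i j : (A + B) i j = A i j + B i j.
Proof. by rewrite mxE. Qed.

Lemma mx_oppE (a : nat) (A : 'M[R]_(a, m)) i j : (- A) i j = - A i j.
Proof. by rewrite mxE. Qed.

End InnerProduct.

(* T is the Jacobian of the immersion, g the ambient metric along it; Om u and
   om u are the matrices, in the row vector convention, of the ambient and of
   the intrinsic connection in the direction u. *)
Section Submanifold.
Context {R : realType} {X : Type} {m n : nat} {U : diff_calculus R X 'rV[R]_m}.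
Local Notation D := (@der _ _ _ U _ _).
Local Notation sm := (@smooth _ _ _ U _ _).
Local Notation covd := (covd U).
Local Notation curv := (curv U).
Variables (T : X -> 'M[R]_(m, n)) (g : X -> 'M[R]_n) (J : 'M[R]_n) (c : R).
Variables (Om : 'rV[R]_m -> X -> 'M[R]_n) (om : 'rV[R]_m -> X -> 'M[R]_m).
Hypotheses (sT : sm T) (sg : sm g) (sOm : forall u, sm (Om u)) (som : forall u, sm (om u)).
Hypotheses (g_sym : forall q, U q -> (g q)^T = g q)
  (g_pos : forall q (u : 'rV[R]_n), U q -> u != 0 -> 0 < ip (g q) u u)
  (T_inj : forall q (u : 'rV[R]_m), U q -> u *m T q = 0 -> u = 0).
Hypotheses (Dg : forall u q, U q -> D u g q = Om u q *m g q + g q *m (Om u q)^T)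
  (torsion_free : forall (u v : 'rV[R]_m) q, U q -> v *m covd Om u T q = u *m covd Om v T q).

Definition first_form q : 'M[R]_m := locked (T q *m g q *m (T q)^T).

Lemma first_formE q : first_form q = T q *m g q *m (T q)^T.
Proof. by rewrite /first_form -lock. Qed.

Hypotheses (Dgam : forall u q, U q ->
    D u first_form q = om u q *m first_form q + first_form q *m (om u q)^T)
  (om_torsion_free : forall (u v : 'rV[R]_m) q, U q -> v *m om u q = u *m om v q).

(** In the row vector convention, [v *m shape_mx u q] is h(u, v). *)
Definition shape_mx u q : 'M[R]_(m, n) := locked (covd Om u T q - om u q *m T q).
Local Notation H := shape_mx.

Lemma shape_mxE u q : H u q = covd Om u T q - om u q *m T q.
Proof. by rewrite /shape_mx -lock. Qed.

Let sH u : sm (H u).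
Proof.
apply: (@smooth_eq _ _ _ _ _ _ (fun q => covd Om u T q - om u q *m T q)).
  by move=> q _; rewrite shape_mxE.
by apply: smooth_sub; [exact: smooth_covd|exact: smooth_mul].
Qed.

Let sTt : sm (fun q => (T q)^T). Proof. exact: smooth_tr. Qed.

Let sgam : sm first_form.
Proof.
apply: (@smooth_eq _ _ _ _ _ _ (fun q => T q *m g q *m (T q)^T)).
  by move=> q _; rewrite first_formE.
by apply: smooth_mul => //; exact: smooth_mul.
Qed.

Let D_pairing a b u (A : X -> 'M[R]_(a, n)) (B : X -> 'M[R]_(b, n)) q : U q ->
  sm A -> sm B -> D u (fun q => A q *m g q *m (B q)^T) q =
    covd Om u A q *m g q *m (B q)^T + A q *m g q *m (covd Om u B q)^T.
Proof.
move=> Uq sA sB; have sB' := smooth_tr sB.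
rewrite !der_mul ?der_tr ?Dg//; last exact: smooth_mul.
by rewrite !covdE; mx_abel.
Qed.

Lemma shape_mxC u v q : U q -> v *m H u q = u *m H v q.
Proof.
move=> Uq; rewrite !shape_mxE.
have -> : v *m (covd Om u T q - om u q *m T q) = v *m covd Om u T q - v *m om u q *m T q.
  by mx_abel.
by rewrite torsion_free// om_torsion_free//; mx_abel.
Qed.

Lemma covd_tangent u q : covd Om u T q = H u q + om u q *m T q.
Proof. by rewrite shape_mxE subrK. Qed.

(** The trilinear form < h(u, v), T w > is symmetric in u, v since both connections are
    torsion-free, and skew in v, w since both are metric; such a form is zero. *)
Lemma shape_mx_normal u q : U q -> H u q *m g q *m (T q)^T = 0.
Proof.
move=> Uq; have asym v : H v q *m g q *m (T q)^T + T q *m g q *m (H v q)^T = 0.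
  have := D_pairing v Uq sT sT; rewrite -(der_eq v Uq (fun r _ => first_formE r)).
  rewrite Dgam// first_formE !covd_tangent => /eqP; rewrite eq_sym -subr_eq0 => /eqP <-.
  by mx_abel.
pose N (u v w : 'rV[R]_m) := (v *m (H u q *m g q *m (T q)^T) *m w^T) 0 0.
have N12 a b d : N a b d = N b a d.
  by rewrite /N !mxA shape_mxC.
have N23 a b d : N a b d = - N a d b.
  have /(congr1 (fun M : 'M[R]_m => (b *m M *m d^T) 0 0)) := asym a.
  rewrite mxDr mxDl mx0r mx0l [RHS]mxE [LHS]mxE -/(N _ _ _).
  have -> : (b *m (T q *m g q *m (H a q)^T) *m d^T) 0 0 = N a d b.
    rewrite /N; have e : d *m (H a q *m g q *m (T q)^T) *m b^T =
      (b *m (T q *m g q *m (H a q)^T) *m d^T)^T by rewrite !mxtrM !trmxK g_sym// !mxA.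
    by rewrite e [RHS]mxE.
  by move/eqP; rewrite addr_eq0 => /eqP.
apply: bilinear_eq0_mx => v w; rewrite -/(N u v w).
have := N12 u v w; have := N23 u v w; have := N12 v w u; have := N23 w v u.
have := N12 w u v; have := N23 u w v; have := N23 v u w; lra.
Qed.

Lemma covd_normal a u (xi : X -> 'M[R]_(a, n)) q : U q -> sm xi ->
  (forall q, U q -> xi q *m g q *m (T q)^T = 0) ->
  covd Om u xi q *m g q *m (T q)^T = - (xi q *m g q *m (H u q)^T).
Proof.
move=> Uq sx nx; have := D_pairing u Uq sx sT.
rewrite (der_eq u Uq nx) der_cst covd_tangent => /eqP; rewrite eq_sym addr_eq0 => /eqP ->.
by rewrite mxtrD mxtrM mxDr (mxA _ _ (om u q)^T) nx// mx0l addr0.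
Qed.

(** Commutes two covariant derivatives of [T], using nabla T = H + om T. The tangential part gives
    the Gauss equation, the normal part that of Codazzi. *)
Lemma gauss_codazzi u v q : U q ->
  T q *m curv Om u v q = curv om u v q *m T q
    + (covd Om u (H v) q + om v q *m H u q) - (covd Om v (H u) q + om u q *m H v q).
Proof.
move=> Uq; rewrite -covd_comm//.
have E a b : covd Om a (covd Om b T) q =
    covd Om a (H b) q + (D a (om b) q *m T q + om b q *m (H a q + om a q *m T q)).
  rewrite (@covd_eq _ _ _ _ _ _ _ _ _ (fun q => H b q + om b q *m T q))//; last first.
    by move=> r _; exact: covd_tangent.
  rewrite covd_add ?covd_mul//; last exact: smooth_mul.
  by rewrite covd_tangent.
by rewrite !E curvE; mx_abel.
Qed.

Lemma gauss u v q : U q ->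
  T q *m curv Om u v q *m g q *m (T q)^T =
    curv om u v q *m first_form q - H v q *m g q *m (H u q)^T + H u q *m g q *m (H v q)^T.
Proof.
move=> Uq; rewrite gauss_codazzi//.
have nH w r : U r -> H w r *m g r *m (T r)^T = 0 by exact: shape_mx_normal.
have dist (K : 'M[R]_m) (A B C E : 'M[R]_(m, n)) :
    (K *m T q + (A + B) - (C + E)) *m g q *m (T q)^T = K *m first_form q
    + (A *m g q *m (T q)^T + B *m g q *m (T q)^T)
    - (C *m g q *m (T q)^T + E *m g q *m (T q)^T).
  by rewrite first_formE; mx_abel.
have e w z : om w q *m H z q *m g q *m (T q)^T = 0.
  by rewrite -(mxA (om w q)) -(mxA (om w q)) nH// mx0r.
by rewrite dist !e (covd_normal u Uq (sH v) (nH v)) (covd_normal v Uq (sH u) (nH u)) !addr0 opprK.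
Qed.

Definition normal_proj a q (xi : 'M[R]_(a, n)) : 'M[R]_(a, n) :=
  locked (xi - xi *m g q *m (T q)^T *m invmx (first_form q) *m T q).

Lemma normal_projE a q (xi : 'M[R]_(a, n)) :
  normal_proj q xi = xi - xi *m g q *m (T q)^T *m invmx (first_form q) *m T q.
Proof. by rewrite /normal_proj -lock. Qed.

Definition normal_covd a u (xi : X -> 'M[R]_(a, n)) q : 'M[R]_(a, n) :=
  normal_proj q (covd Om u xi q).

(** [xi *m shape_op u q] is A_xi u: the linear form < xi, h(u, .) > with its index raised by the
    first fundamental form. *)
Definition shape_op u q : 'M[R]_(n, m) :=
  locked (g q *m (H u q)^T *m invmx (first_form q)).

Lemma shape_opE u q : shape_op u q = g q *m (H u q)^T *m invmx (first_form q).
Proof. by rewrite /shape_op -lock. Qed.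

Let first_form_unit q : U q -> first_form q \in unitmx.
Proof.
move=> Uq; apply: ip_unitmx => u u0.
rewrite /ip first_formE !mxA -(mxA _ _ u^T) -mxtrM -/(ip (g q) (u *m T q) (u *m T q)).
apply: g_pos => //; apply: contra u0 => /eqP uT; apply/eqP; exact: T_inj Uq uT.
Qed.

(** By Weingarten's formula ([nE]) the normal derivative is nabla xi + A_xi T. Against a normal V
    the outer projection and every multiple of [T] disappear, and differentiating A_xi T leaves only
    A_xi H. *)
Lemma ricci a u v (xi : X -> 'M[R]_(a, n)) (V : 'rV[R]_n) q : U q -> sm xi ->
  (forall q, U q -> xi q *m g q *m (T q)^T = 0) -> T q *m g q *m V^T = 0 ->
  (normal_covd u (normal_covd v xi) q - normal_covd v (normal_covd u xi) q) *m g q *m V^T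
  = (xi q *m curv Om u v q + xi q *m shape_op v q *m H u q
      - xi q *m shape_op u q *m H v q) *m g q *m V^T.
Proof.
move=> Uq sx nx nV.
have s_inv : sm (fun q => invmx (first_form q)) by exact: smooth_inv.
have sS w : sm (shape_op w).
  apply: (@smooth_eq _ _ _ _ _ _ (fun q => g q *m (H w q)^T *m invmx (first_form q))).
    by move=> r _; rewrite shape_opE.
  by apply: smooth_mul => //; apply: smooth_mul => //; exact: smooth_tr.
have sxS w : sm (fun q => xi q *m shape_op w q) by exact: smooth_mul.
have sxST w : sm (fun q => xi q *m shape_op w q *m T q) by exact: smooth_mul.
have scx w : sm (covd Om w xi) by exact: smooth_covd.
have nE w r : U r -> normal_covd w xi r = covd Om w xi r + xi r *m shape_op w r *m T r.
  by move=> Ur; rewrite /normal_covd normal_projE covd_normal// shape_opE; mx_abel.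
have pV (M : 'M[R]_(a, n)) : normal_proj q M *m g q *m V^T = M *m g q *m V^T.
  by rewrite normal_projE !(mxDl, mxNl) -(mxA _ (T q)) -(mxA _ (T q *m _)) nV mx0r subr0.
have E a' b' : normal_covd a' (normal_covd b' xi) q *m g q *m V^T =
   (covd Om a' (covd Om b' xi) q + xi q *m shape_op b' q *m H a' q) *m g q *m V^T.
  rewrite /normal_covd pV (covd_eq Om a' Uq (nE b')) covd_add// covd_mul// covd_tangent.
  have z (M : 'M[R]_(a, m)) : M *m T q *m g q *m V^T = 0.
    by rewrite -(mxA _ (T q)) -(mxA _ (T q *m _)) nV mx0r.
  have dist (A : 'M[R]_(a, n)) (B C : 'M[R]_(a, m)) (K : 'M[R]_(m, n)) :
      (A + (B *m T q + C *m (K + om a' q *m T q))) *m g q *m V^T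
      = (A + C *m K) *m g q *m V^T + B *m T q *m g q *m V^T
        + C *m om a' q *m T q *m g q *m V^T.
    by mx_abel.
  by rewrite dist !z !addr0.
have dist (A B : 'M[R]_(a, n)) : (A - B) *m g q *m V^T = A *m g q *m V^T - B *m g q *m V^T.
  by mx_abel.
rewrite -covd_comm//; apply: etrans (dist _ _) _.
apply: etrans (congr2 (fun M N => M - N) (E u v) (E v u)) _.
by mx_abel.
Qed.

Lemma covd_shape_mxC u v w q : U q -> w *m covd Om u (H v) q = v *m covd Om u (H w) q.
Proof.
move=> Uq; rewrite -!covd_mull//; apply: covd_eq => // r Ur; exact: shape_mxC.
Qed.

(** The direction [a r] varies, whereas [H u] is differentiated for constant [u]. Symmetry of h
    moves the direction to the left factor: [W r] is the matrix [H (b r) r] assembled row by row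
    from constant directions. *)
Lemma covd_second_form u (a b : X -> 'rV[R]_m) q : U q -> sm a -> sm b ->
  covd Om u (fun r => b r *m H (a r) r) q =
    D u b q *m H (a q) q + b q *m covd Om u (H (a q)) q + b q *m H (D u a q) q.
Proof.
move=> Uq sa sb.
pose W r := \sum_i (delta_mx i 0 : 'M[R]_(m, 1)) *m (b r *m H (delta_mx 0 i) r).
have sW1 i : sm (fun r => b r *m H (delta_mx 0 i) r) by exact: smooth_mul.
have sW2 i : sm (fun r => (delta_mx i 0 : 'M[R]_(m, 1)) *m (b r *m H (delta_mx 0 i) r)).
  by apply: (smooth_mul (A := fun=> _)) => //; exact: smooth_cst.
have rows (M : 'M[R]_(m, n)) :
    \sum_i (delta_mx i 0 : 'M[R]_(m, 1)) *m ((delta_mx 0 i : 'rV[R]_m) *m M) = M.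
  have e : M = 1%:M *m M by rewrite mul1mx.
  rewrite [RHS]e mx1_sum_delta mulmx_suml; apply: eq_bigr => i _.
  by rewrite mxA mul_delta_mx.
have WE r : U r -> W r = H (b r) r.
  by move=> Ur; rewrite -[RHS]rows; apply: eq_bigr => i _; rewrite (shape_mxC _ (b r)).
have covW : covd Om u W q = H (D u b q) q + covd Om u (H (b q)) q.
  rewrite covd_sum// -[RHS]rows; apply: eq_bigr => i _.
  by rewrite covd_mull// covd_mul// mxDr (shape_mxC _ (D u b q))// covd_shape_mxC// -mxDr.
rewrite (covd_eq (eta := fun r => a r *m W r) Om u Uq); last first.
  by move=> r Ur; rewrite WE// shape_mxC.
rewrite covd_mul//; last exact: smooth_sum.
rewrite WE// covW mxDr shape_mxC// (shape_mxC _ (a q))// (covd_shape_mxC _ _ (a q))//.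
by rewrite addrC addrAC.
Qed.

Definition tangent_J q : 'M[R]_m :=
  locked (T q *m J *m g q *m (T q)^T *m invmx (first_form q)).
Local Notation P := tangent_J.

Lemma tangent_JE q : P q = T q *m J *m g q *m (T q)^T *m invmx (first_form q).
Proof. by rewrite /tangent_J -lock. Qed.

Definition covd_tangent_J u q : 'M[R]_m :=
  locked (D u P q + P q *m om u q - om u q *m P q).

Lemma covd_tangent_JE u q :
  covd_tangent_J u q = D u P q + P q *m om u q - om u q *m P q.
Proof. by rewrite /covd_tangent_J -lock. Qed.

Hypotheses (JJ : J *m J = - 1%:M)
  (J_iso : forall q, U q -> J *m g q *m J^T = g q)
  (J_par : forall u q, U q -> J *m Om u q = Om u q *m J).

Lemma tangent_J_form q : U q -> P q *m first_form q = T q *m J *m g q *m (T q)^T.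
Proof. by move=> Uq; rewrite tangent_JE -mxA mulVmx ?mulmx1//; exact: first_form_unit. Qed.

Let sP : sm P.
Proof.
apply: (@smooth_eq _ _ _ _ _ _
  (fun q => T q *m J *m g q *m (T q)^T *m invmx (first_form q))).
  by move=> r _; rewrite tangent_JE.
apply: smooth_mul; last exact: smooth_inv.
do 2![apply: smooth_mul => //]; apply: smooth_mul => //; exact: smooth_cst.
Qed.

(** Differentiates < J T, T > with J parallel: the [H]-parts of nabla T give the right-hand side,
    the [om]-parts complete D P to nabla P. *)
Lemma covd_tangent_J_form u q : U q ->
  covd_tangent_J u q *m first_form q =
    H u q *m J *m g q *m (T q)^T + T q *m J *m g q *m (H u q)^T.
Proof.
move=> Uq; have sTJ : sm (fun r => T r *m J).
  by apply: (smooth_mul (B := fun=> J)) => //; exact: smooth_cst.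
have cTJ : covd Om u (fun r => T r *m J) q = (H u q + om u q *m T q) *m J.
  rewrite -covd_tangent !covdE (der_mul (B := fun=> J))//; last exact: smooth_cst.
  by rewrite der_cst mx0r addr0 mxDl -!mxA J_par.
have := D_pairing u Uq sTJ sT; rewrite cTJ covd_tangent.
rewrite -(der_eq u Uq tangent_J_form) der_mul// Dgam// => e.
have -> : covd_tangent_J u q *m first_form q = D u P q *m first_form q
    + P q *m (om u q *m first_form q + first_form q *m (om u q)^T)
    - om u q *m (P q *m first_form q) - P q *m first_form q *m (om u q)^T.
  by rewrite covd_tangent_JE; mx_abel.
by rewrite e tangent_J_form//; mx_abel.
Qed.

Hypotheses (CR : forall q, U q -> P q *m T q *m J = P q *m P q *m T q)
  (c0 : c != 0)
  (space_form_curvature : forall u v (xi eta : 'rV[R]_n) q, U q ->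
    ip (g q) (xi *m curv Om u v q) eta
      = c * space_form (mulmxr J) (ip (g q)) (u *m T q) (v *m T q) xi eta)
  (holo_dim : forall q (z : 'rV[R]_m), U q -> exists x : 'rV[R]_m,
    [/\ x *m P q *m P q = - x, x != 0, ip (g q) (x *m T q) (z *m T q) = 0 &
        ip (g q) (x *m P q *m T q) (z *m T q) = 0])
  (semi_par : forall (u v z w : 'rV[R]_m) q, U q ->
    normal_covd u (normal_covd v (fun r => w *m H z r)) q
      - normal_covd v (normal_covd u (fun r => w *m H z r)) q
      - w *m H (z *m curv om u v q) q - w *m curv om u v q *m H z q = 0).

Lemma J_tangent (x : 'rV[R]_m) q : U q ->
  x *m P q *m T q *m J = x *m P q *m P q *m T q.
Proof. by move=> Uq; rewrite -!(mxA x) CR. Qed.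

Lemma tangent_J_cube (x : 'rV[R]_m) q : U q ->
  x *m P q *m P q *m P q = - (x *m P q).
Proof.
move=> Uq; apply/eqP; rewrite -addr_eq0; apply/eqP; apply: (T_inj Uq).
by rewrite mxDl -!J_tangent// -(mxA _ J) JJ mxNr mulmx1; exact: addNr.
Qed.

Section AtPoint.
Variable q : X.
Hypothesis Uq : U q.

Let h (x y : 'rV[R]_m) := y *m H x q.
Let b := ip (g q).
Let S (V : 'rV[R]_n) x := V *m shape_op x q.

Let bC x y : b x y = b y x. Proof. by apply: ipC; exact: g_sym. Qed.

Let tan_of (e : 'rV[R]_n) := e *m g q *m (T q)^T *m invmx (first_form q).

Let tan_ofE e (y : 'rV[R]_m) : b (tan_of e *m T q) (y *m T q) = b e (y *m T q).
Proof.
rewrite /b /ip /tan_of; congr (fun_of_matrix _ 0 0); rewrite mxtrM.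
rewrite -(mxA _ (invmx _) (T q)) -(mxA _ _ (g q)) -(mxA _ _ ((T q)^T *m y^T)).
have -> : invmx (first_form q) *m T q *m g q *m ((T q)^T *m y^T) = y^T.
  rewrite -(mxA _ (T q)) -(mxA _ _ ((T q)^T *m y^T)) (mxA (T q *m g q)).
  by rewrite -first_formE (mxA (invmx _)) mulVmx ?mul1mx//; exact: first_form_unit.
by rewrite !mxA.
Qed.

Let ShE V x y : b (S V x *m T q) (y *m T q) = b V (h x y).
Proof.
rewrite /b /ip /S shape_opE /h; congr (fun_of_matrix _ 0 0).
have -> : V *m (g q *m (H x q)^T *m invmx (first_form q)) *m T q *m g q *m (y *m T q)^T
  = V *m g q *m (H x q)^T *m (invmx (first_form q) *m first_form q) *m y^T.
  by move: (invmx _) => G; rewrite first_formE !mxtrM !mxA.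
by rewrite mulVmx ?mulmx1 ?mxtrM ?mxA//; exact: first_form_unit.
Qed.

Let hC x y : h x y = h y x. Proof. exact: shape_mxC. Qed.
Let hn x y z : b (h x y) (z *m T q) = 0.
Proof.
rewrite /b /ip /h mxtrM !mxA -(mxA y) -(mxA y) shape_mx_normal//.
by rewrite mx0r mx0l mxE.
Qed.

Let normalE V : (forall z : 'rV[R]_m, b V (z *m T q) = 0) -> T q *m g q *m V^T = 0.
Proof.
move=> nV; apply: bilinear_eq0_mx => u v.
have -> : v^T = v 0 0 *: 1%:M.
  by apply/matrixP => i j; rewrite !ord1 !mxE eqxx mulr1.
rewrite -scalemxAr mulmx1 mxE; have := nV u; rewrite bC /b /ip !mxA.
by move=> ->; rewrite mulr0.
Qed.

Lemma tangent_J_ip (x y : 'rV[R]_m) : b (x *m P q *m T q) (y *m T q) = b (x *m T q *m J) (y *m T q).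
Proof.
rewrite /b /ip; congr (fun_of_matrix _ 0 0).
have -> : x *m P q *m T q *m g q *m (y *m T q)^T = x *m (P q *m first_form q) *m y^T.
  by rewrite first_formE; mx_abel.
by rewrite tangent_J_form//; mx_abel.
Qed.

Let curv_b u v xi eta : b (xi *m curv Om u v q) eta
  = c * space_form (mulmxr J) b (u *m T q) (v *m T q) xi eta.
Proof. exact: space_form_curvature. Qed.

Let semi_par_b x y z w V : (forall z : 'rV[R]_m, b V (z *m T q) = 0) ->
  c * space_form (mulmxr J) b (x *m T q) (y *m T q) (h z w) V
    + b (S V x *m T q) (S (h z w) y *m T q) - b (S V y *m T q) (S (h z w) x *m T q)
  = (c * space_form (mulmxr J) b (x *m T q) (y *m T q) (z *m T q) (S V w *m T q)
      + b (h y z) (h x (S V w)) - b (h x z) (h y (S V w)))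
  + (c * space_form (mulmxr J) b (x *m T q) (y *m T q) (w *m T q) (S V z *m T q)
      + b (h y w) (h x (S V z)) - b (h x w) (h y (S V z))).
Proof.
move=> nV; have nV' := normalE nV.
have nH v r : U r -> w *m H v r *m g r *m (T r)^T = 0.
  by move=> Ur; rewrite -(mxA w) -(mxA w) shape_mx_normal// mx0r.
have sx : sm (fun r => w *m H z r).
  by apply: (smooth_mul (A := fun=> w)) => //; exact: smooth_cst.
have E : b (w *m H (z *m curv om x y q) q + w *m curv om x y q *m H z q) V =
    b (w *m H z q *m curv Om x y q + w *m H z q *m shape_op y q *m H x q
        - w *m H z q *m shape_op x q *m H y q) V.
  rewrite /b /ip -(ricci x y Uq sx (fun r => @nH z r) nV'); congr (fun_of_matrix (_ *m _ *m _) 0 0).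
  by have /eqP := semi_par x y z w Uq; rewrite -addrA -opprD subr_eq0 => /eqP.
have R1 t s' r : b (s' *m shape_op r q *m H t q) V = b (S V t *m T q) (S s' r *m T q).
  by rewrite ShE bC.
(* The shape operator moves the pairing of h(R(x, y) r, s') with V onto < R(x, y) r, A_V s' >, where
   the Gauss equation applies. *)
have G1 s' r : b (s' *m H (r *m curv om x y q) q) V =
    c * space_form (mulmxr J) b (x *m T q) (y *m T q) (r *m T q) (S V s' *m T q)
    + b (h y r) (h x (S V s')) - b (h x r) (h y (S V s')).
  rewrite -/(h _ s') hC bC -ShE -space_form_curvature//; set t := S V s'.
  have := gauss x y Uq => /(congr1 (fun M : 'M[R]_m => r *m M *m t^T)).
  rewrite [b (t *m T q) _]bC /b /ip /h; move: (curv Om x y q) (curv om x y q) => K k e.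
  have -> : r *m k *m T q *m g q *m (t *m T q)^T
      = r *m T q *m K *m g q *m (t *m T q)^T + r *m H y q *m g q *m (t *m H x q)^T
        - r *m H x q *m g q *m (t *m H y q)^T.
    have -> : r *m T q *m K *m g q *m (t *m T q)^T = r *m (T q *m K *m g q *m (T q)^T) *m t^T.
      by mx_abel.
    by rewrite e first_formE; mx_abel.
  by rewrite mx_addE mx_oppE mx_addE.
move: E; rewrite /b ipBl !ipDl -/b !R1 curv_b G1.
have -> : w *m curv om x y q *m H z q = z *m H (w *m curv om x y q) q by exact: shape_mxC.
by rewrite G1 -!/(h _ _) => ->.
Qed.

Let JP (x : 'rV[R]_m) : x *m P q *m T q *m J = x *m P q *m P q *m T q.
Proof. exact: J_tangent. Qed.

Let bDl x x' y : b (x + x') y = b x y + b x' y. Proof. exact: ipDl. Qed.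
Let bB x x' y : b (x - x') y = b x y - b x' y. Proof. exact: ipBl. Qed.
Let bZl k x y : b (k *: x) y = k * b x y. Proof. exact: ipZl. Qed.
Let b_gt0 x : x != 0 -> 0 < b x x. Proof. exact: g_pos. Qed.
Let bJ (x y : 'rV[R]_n) : b (x *m J) (y *m J) = b x y.
Proof.
rewrite /b /ip mxtrM !mxA; congr (fun_of_matrix _ 0 0).
have -> : x *m J *m g q *m J^T = x *m (J *m g q *m J^T) by rewrite !mxA.
by rewrite J_iso.
Qed.
Let hD x y y' : h x (y + y') = h x y + h x y'. Proof. exact: mxDl. Qed.
Let hZ k x y : h x (k *: y) = k *: h x y. Proof. by rewrite /h -scalemxAl. Qed.
Let T_inj' : injective (mulmxr (T q) : 'rV[R]_m -> 'rV[R]_n).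
Proof.
move=> x y /= /eqP; rewrite -subr_eq0 -mulmxBl => /eqP/(T_inj Uq)/eqP.
by rewrite subr_eq0 => /eqP.
Qed.
Let JJ' (x : 'rV[R]_n) : x *m J *m J = - x. Proof. by rewrite -mxA JJ mxNr mulmx1. Qed.

Let holo_dim' (z : 'rV[R]_m) : exists x : 'rV[R]_m,
  [/\ x *m P q *m P q = - x, 0 < b (x *m T q) (x *m T q),
  b (x *m T q) (z *m T q) = 0 & b (x *m P q *m T q) (z *m T q) = 0].
Proof.
have [x [hx x0 xz Pxz]] := holo_dim z Uq; exists x; split=> //.
by apply: b_gt0; apply: contra x0 => /eqP/(T_inj Uq) ->.
Qed.

Lemma shape_mx_mixed (z w : 'rV[R]_m) : z *m P q *m P q = - z -> w *m P q = 0 -> w *m H z q = 0.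
Proof.
move=> hz ow.
exact: (@second_form_mixed R 'rV[R]_m 'rV[R]_n (mulmxr J) b (mulmxr (T q))
  (mulmxr (P q)) h S c JJ' bDl bZl bC b_gt0 bJ T_inj' tangent_J_ip JP hZ hC hn ShE c0
  semi_par_b holo_dim' z w hz ow).
Qed.

Let dP u (x : 'rV[R]_m) := x *m covd_tangent_J u q.

Let dPE u x y : b (dP u x *m T q) (y *m T q) =
  b (h u x *m J) (y *m T q) + b (x *m T q *m J) (h u y).
Proof.
rewrite /b /ip /dP /h.
have -> : x *m covd_tangent_J u q *m T q *m g q *m (y *m T q)^T
    = x *m (covd_tangent_J u q *m first_form q) *m y^T.
  by rewrite first_formE; mx_abel.
rewrite covd_tangent_J_form// -mx_addE; congr (fun_of_matrix _ 0 0).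
by rewrite !mxtrM mxDr mxDl !mxA.
Qed.

(* The covariant derivative of the second fundamental form. *)
Let C u v w V := b (w *m covd Om u (H v) q - w *m H (v *m om u q) q
  - w *m om u q *m H v q) V.

Let codazzi u v w V : (forall z : 'rV[R]_m, b V (z *m T q) = 0) ->
  C u v w V - C v u w V =
    c * space_form (mulmxr J) b (u *m T q) (v *m T q) (w *m T q) V.
Proof.
move=> nV; rewrite -curv_b.
have -> : w *m T q *m curv Om u v q = w *m (T q *m curv Om u v q) by rewrite mxA.
rewrite gauss_codazzi//.
have -> : w *m (curv om u v q *m T q + (covd Om u (H v) q + om v q *m H u q)
      - (covd Om v (H u) q + om u q *m H v q))
    = w *m curv om u v q *m T q
      + ((w *m covd Om u (H v) q - w *m H (v *m om u q) q - w *m om u q *m H v q)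
      - (w *m covd Om v (H u) q - w *m H (v *m om u q) q - w *m om v q *m H u q)).
  by mx_abel.
rewrite bDl bB (_ : b (_ *m T q) V = 0) ?add0r; last by rewrite bC nV.
by rewrite /C (om_torsion_free v u Uq).
Qed.

(** The vanishing of h(D, D') is required on all of [U], because [mixed_derivative] differentiates
    it at [q]. *)
Lemma semi_parallel_absurd :
  (forall (z w : 'rV[R]_m) r, U r -> z *m P r *m P r = - z -> w *m P r = 0 ->
     w *m H z r = 0) ->
  (exists2 w : 'rV[R]_m, w *m P q = 0 & w != 0) -> False.
Proof.
move=> mixed orth_dim.
have PPPr := tangent_J_cube.
have orthQ (y : 'rV[R]_m) r : U r -> (y + y *m P r *m P r) *m P r = 0.
  by move=> Ur; rewrite mxDl PPPr// subrr.
have mixed_derivative u x y V :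
    C u (x *m P q) (y + y *m P q *m P q) V + b (h (dP u x) (y + y *m P q *m P q)) V
      + b (h (x *m P q) (dP u (y *m P q) + dP u y *m P q)) V = 0.
  have sa : sm (fun r => x *m P r) by apply: (smooth_mul (A := fun=> x)) => //; exact: smooth_cst.
  have syP : sm (fun r => y *m P r) by apply: (smooth_mul (A := fun=> y)) => //; exact: smooth_cst.
  have sb : sm (fun r => y + y *m P r *m P r).
    by apply: (smooth_add (A := fun=> y)); [exact: smooth_cst|exact: smooth_mul].
  have := covd_second_form u Uq sa sb.
  rewrite (covd_eq (eta := fun=> 0) Om u Uq); last first.
    by move=> r Ur; apply: mixed => //; [exact: PPPr|exact: orthQ].
  rewrite covdE der_cst mx0l addr0.
  have -> : D u (fun r => x *m P r) q = x *m D u P q.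
    by rewrite (der_mul (A := fun=> x))// ?der_cst ?mx0l ?add0r//; exact: smooth_cst.
  have -> : D u (fun r => y + y *m P r *m P r) q
      = y *m D u P q *m P q + y *m P q *m D u P q.
    rewrite (der_add (A := fun=> y))//; [|exact: smooth_cst|exact: smooth_mul].
    rewrite der_cst add0r der_mul//; congr (_ *m _ + _).
    by rewrite (der_mul (A := fun=> y))// ?der_cst ?mx0l ?add0r//; exact: smooth_cst.
  set v := x *m P q; set w := y + y *m P q *m P q => e.
  rewrite /C /b -!ipDl /h /dP !covd_tangent_JE.
  (* Passing from plain to covariant derivatives of the two fields adds only terms that are again
     values of h on D and D', hence zero. *)
  have f1 : x *m om u q *m P q *m H w q = 0.
    by rewrite shape_mxC//; exact: (mixed _ _ q Uq (PPPr _ q Uq) (orthQ _ q Uq)).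
  have f2 : (y *m om u q + y *m om u q *m P q *m P q) *m H v q = 0.
    by exact: (mixed _ _ q Uq (PPPr _ q Uq) (orthQ _ q Uq)).
  rewrite (shape_mxC (v *m om u q) w)// (shape_mxC (x *m _) w)//.
  rewrite (shape_mxC (x *m D u P q) w)// in e.
  set Z := (X in ip (g q) X V).
  suff -> : Z = 0 by rewrite ip0l.
  rewrite /Z; move: (H w q) (H v q) (covd Om u (H v) q) f1 f2 e => Hw Hv K f1 f2 e.
  transitivity ((y *m D u P q *m P q + y *m P q *m D u P q) *m Hv + w *m K + x *m D u P q *m Hw
    - x *m om u q *m P q *m Hw - (y *m om u q + y *m om u q *m P q *m P q) *m Hv).
    by rewrite /v /w; mx_abel.
  by rewrite -e f1 f2 !subr0.
exact: (@semi_parallel_contradiction R 'rV[R]_m 'rV[R]_n (mulmxr J) b (mulmxr (T q))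
  (mulmxr (P q)) h S c JJ' bDl bZl bC b_gt0 bJ T_inj' tangent_J_ip JP hD hZ hC hn ShE c0
  semi_par_b holo_dim' tan_of dP C tan_ofE dPE codazzi
  (fun u x y V _ => mixed_derivative u x y V) orth_dim).
Qed.

End AtPoint.

Theorem semi_parallel_holo_dim q : U q -> ~ exists2 w : 'rV[R]_m, w *m P q = 0 & w != 0.
Proof.
move=> Uq; apply: (semi_parallel_absurd Uq) => z w r Ur; exact: shape_mx_mixed.
Qed.

End Submanifold.

(** * Smooth functions *)

Local Open Scope classical_set_scope.
Local Open Scope ring_scope.

(** * Symmetry of second derivatives *)

Section Schwarz.
Context {R : realType} {V : normedModType R}.
Implicit Types (f : V -> R) (p u v : V).

Lemma differentiable_approx f p e : differentiable f p -> 0 < e ->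
  exists2 d, 0 < d & forall h : V, `|h| < d ->
    `|f (p + h) - f p - 'd f p h| <= e * `|h|.
Proof.
move=> df e0; have := diff_locallyxC df; set k := 'o _ => fE.
have /(littleoP [littleo of k])/nbhs_ballP[d /= d0 H] := e0.
exists d => // h hd; rewrite fE.
have -> : f p + 'd f p h + k h - f p - 'd f p h = k h by ring.
by apply: H; rewrite -ball_normE/= sub0r normrN.
Qed.

Lemma is_derive_line f p w (s : R) : differentiable f (p + s *: w) ->
  is_derive s 1 (fun t : R => f (p + t *: w)) ('D_w f (p + s *: w)).
Proof.
move=> df.
have E : (fun h : R => h^-1 *: (f (h *: w + (p + s *: w)) - f (p + s *: w)))
       = (fun h : R => h^-1 *: (f (p + (h *: (1 : R) + s) *: w) - f (p + s *: w))).
  apply/funext => h; congr (_ *: (f _ - _)).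
  by rewrite [h *: 1]mulr1 scalerDl addrCA.
apply: DeriveDef; last by rewrite /derive -E.
by rewrite /derivable -E; exact: diff_derivable.
Qed.

(** Mean value theorem for s |-> f(p + t v + s u) - f(p + s u) on [0, t]. *)
Lemma second_difference f p u v (t : R) : 0 < t ->
  (forall s : R, 0 <= s <= t -> differentiable f (p + s *: u + t *: v)) ->
  (forall s : R, 0 <= s <= t -> differentiable f (p + s *: u)) ->
  exists2 s : R, 0 <= s <= t &
    f (p + t *: u + t *: v) - f (p + t *: u) - (f (p + t *: v) - f p)
      = t * ('D_u f (p + s *: u + t *: v) - 'D_u f (p + s *: u)).
Proof.
move=> t0 d1 d2.
have AC (s : R) : p + s *: u + t *: v = p + t *: v + s *: u by rewrite addrAC.
have d : forall s : R, 0 <= s <= t ->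
    is_derive s 1 (fun s : R => f (p + t *: v + s *: u) - f (p + s *: u))
      ('D_u f (p + t *: v + s *: u) - 'D_u f (p + s *: u)).
  move=> s st; apply: is_deriveB; apply: is_derive_line.
    by rewrite -AC; exact: d1.
  exact: d2.
have [||s] := @MVT R (fun s : R => f (p + t *: v + s *: u) - f (p + s *: u))
  (fun s : R => 'D_u f (p + t *: v + s *: u) - 'D_u f (p + s *: u)) 0 t t0.
- move=> s; rewrite in_itv/= => /andP[s0 st]; apply: d.
  by rewrite !ltW.
- apply: derivable_within_continuous => s; rewrite in_itv/= => st.
  by have [] := d s st.
rewrite in_itv/= => /andP[s0 st] E; exists s; first by rewrite !ltW.
rewrite !scale0r !addr0 subr0 in E.
by rewrite !AC E mulrC.
Qed.

(** The mean value point s is unknown, but it cancels between the first-order expansions of ['D_u f]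
    at the two points; their errors add up to at most e t (2 |u| + |v|). *)
Lemma second_difference_approx (U : set V) f p u v e : open U -> U p ->
  (forall q, U q -> differentiable f q) -> differentiable ('D_u f) p ->
  0 < e ->
  \forall t \near (0 : R)^'+,
    `|f (p + t *: u + t *: v) - f (p + t *: u) - (f (p + t *: v) - f p)
        - t ^+ 2 * 'D_v ('D_u f) p| <= t ^+ 2 * (e * (2 * `|u| + `|v|)).
Proof.
move=> oU Up df d2f e0.
have [d d0 H] := differentiable_approx d2f e0.
have /nbhs_ballP[r /= r0 rU] : nbhs p U by exact: open_nbhs_nbhs.
have M0 : 0 < `|u| + `|v| + 1 by rewrite ltr_wpDl// addr_ge0.
near=> t.
have t0 : 0 < t by [].
have tM : t * (`|u| + `|v| + 1) < Num.min d r.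
  rewrite -ltr_pdivlMr//.
  by near: t; apply: nbhs_right_lt; rewrite divr_gt0// lt_min d0.
have small (s s' : R) : 0 <= s <= t -> 0 <= s' <= t -> `|s *: u + s' *: v| < Num.min d r.
  move=> /andP[s0 st] /andP[s'0 s't]; apply: le_lt_trans tM.
  rewrite (le_trans (ler_normD _ _))// !normrZ !ger0_norm// !mulrDr mulr1.
  by rewrite ler_wpDr// ?(ltW t0)// lerD// ler_wpM2r.
have inU w : `|w| < Num.min d r -> U (p + w).
  rewrite lt_min => /andP[_ wr]; apply: rU.
  by rewrite -ball_normE/= opprD addrA subrr sub0r normrN.
have tt : 0 <= t <= t by rewrite ltW//= lexx.
have zt : 0 <= (0:R) <= t by rewrite lexx ltW.
have [|s st|s st ->] := @second_difference f p u v t t0.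
- by move=> s st; apply: df; rewrite -addrA; apply/inU/small.
- apply: df; apply: inU; have := small _ _ st zt; by rewrite scale0r addr0.
have := small _ _ st tt; have := small _ _ st zt; rewrite scale0r addr0.
rewrite !lt_min => /andP[h1 _] /andP[h2 _].
move: (H _ h1) (H _ h2); rewrite addrA => {}H1 {}H2.
have dE : 'D_v ('D_u f) p = 'd ('D_u f) p v by rewrite deriveE.
have dZ k w : 'd ('D_u f) p (k *: w) = k * 'd ('D_u f) p w by rewrite linearZ.
have dD w w' : 'd ('D_u f) p (w + w') = 'd ('D_u f) p w + 'd ('D_u f) p w'.
  by rewrite linearD.
rewrite dD !dZ -dE in H1 H2.
have s0 : 0 <= s by case/andP: st.
have s_t : s <= t by case/andP: st.
set a := 'D_u f (p + s *: u + t *: v) in H2 *; set b := 'D_u f (p + s *: u) in H1 *.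
set x := 'D_u f p in H1 H2; set y := s * 'd _ _ _ in H1 H2; set D := 'D_v _ _ in H2 *.
have -> : t * (a - b) - t ^+ 2 * D = t * (a - x - (y + t * D) - (b - x - y)) by ring.
rewrite normrM (gtr0_norm t0) expr2 -mulrA ler_pM2l//.
rewrite (le_trans (ler_normB _ _))// (le_trans (lerD H2 H1))//.
rewrite -mulrDr [leRHS]mulrCA ler_wpM2l ?(ltW e0)//.
have n1 : `|s *: u + t *: v| <= s * `|u| + t * `|v|.
  by rewrite (le_trans (ler_normD _ _))// !normrZ !ger0_norm ?(ltW t0).
have n2 : `|s *: u| = s * `|u| by rewrite normrZ ger0_norm.
have : s * `|u| <= t * `|u| by rewrite ler_wpM2r.
by rewrite n2; move: n1; clear; move: `|_ + _| `|u| `|v| => r1 r2 r3; lra.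
Unshelve. all: by end_near. Qed.

(** The second difference is symmetric in u and v, and divided by t^2 it approximates both mixed
    derivatives. *)
Lemma derive_comm (U : set V) f p u v : open U -> U p ->
  (forall q, U q -> differentiable f q) ->
  differentiable ('D_u f) p -> differentiable ('D_v f) p ->
  'D_v ('D_u f) p = 'D_u ('D_v f) p.
Proof.
move=> oU Up df du dv; set a := LHS; set b := RHS.
apply/eqP; rewrite -subr_eq0 -normr_le0; apply/ler_addgt0Pl => e e0; rewrite addr0.
(* The two error bounds sum to (e / C) * 3 (|u| + |v|), at most e; the 1 keeps C positive when u = v
   = 0. *)
pose C := 3 * (`|u| + `|v| + 1); have C0 : 0 < C.
  by rewrite mulr_gt0// ltr_wpDl// addr_ge0.
have eC : 0 < e / C by rewrite divr_gt0.
near (0 : R)^'+ => t.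
have t0 : 0 < t by [].
have h1 : `|f (p + t *: u + t *: v) - f (p + t *: u) - (f (p + t *: v) - f p)
        - t ^+ 2 * a| <= t ^+ 2 * (e / C * (2 * `|u| + `|v|)).
  by near: t; exact: (second_difference_approx v oU Up df du eC).
have h2 : `|f (p + t *: v + t *: u) - f (p + t *: v) - (f (p + t *: u) - f p)
        - t ^+ 2 * b| <= t ^+ 2 * (e / C * (2 * `|v| + `|u|)).
  by near: t; exact: (second_difference_approx u oU Up df dv eC).
have t20 : 0 < t ^+ 2 by rewrite exprn_gt0.
rewrite -(ler_pM2l t20) -[X in X * `|_|](gtr0_norm t20) -normrM.
rewrite [p + t *: u + t *: v]addrAC in h1.
set x := f (p + t *: v + t *: u) in h1 h2; set y := f (p + t *: u) in h1 h2.
set z := f (p + t *: v) in h1 h2; set w := f p in h1 h2.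
have -> : t ^+ 2 * (a - b) = (x - z - (y - w) - t ^+ 2 * b) - (x - y - (z - w) - t ^+ 2 * a).
  by ring.
rewrite (le_trans (ler_normB _ _))// (le_trans (lerD h2 h1))//.
rewrite -mulrDr ler_pM2l// -mulrDr mulrAC ler_pdivrMr// ler_pM2l// /C.
clear; move: `|u| `|v| => r s; lra.
Unshelve. all: by end_near. Qed.

End Schwarz.

(** * Functions agreeing on an open set, and proofs of smoothness by coinduction *)

Section EqOn.
Context {R : realType} {V W : normedModType R}.
Implicit Types (U : set V) (f g : V -> W).

Lemma derive_eq_on U f g p v : open U -> U p -> (forall q, U q -> f q = g q) ->
  'D_v f p = 'D_v g p.
Proof.
move=> oU Up fg; apply: near_eq_derive.
by near=> q; apply: fg; near: q; exact: open_nbhs_nbhs.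
Unshelve. all: by end_near. Qed.

Lemma differentiable_eq_on U f g p : open U -> U p ->
  (forall q, U q -> f q = g q) -> differentiable f p -> differentiable g p.
Proof.
move=> oU Up fg df.
have gE : g \o shift p = cst (g p) + 'd f p +o_ (0 : V) id.
  apply/eqaddoP => e e0.
  have nU : nbhs (0 : V) [set h | U (h + p)].
    have /nbhs_ballP[r /= r0 rU] : nbhs p U by exact: open_nbhs_nbhs.
    apply/nbhs_ballP; exists r => //= h.
    rewrite -ball_normE/= sub0r normrN => hr; apply: rU.
    by rewrite -ball_normE/= opprD addrC subrK normrN.
  move: (diff_locally df) => /eqaddoP/(_ e e0); apply: filterS2 nU => h /= Uh.
  by rewrite !fctE/= !fg.
have dE := diff_unique (diff_continuous df) gE.
by apply/diff_locallyP; rewrite dE; split=> //; exact: diff_continuous.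
Qed.

Lemma smooth_on_derive U f v : smooth_on U f -> smooth_on U ('D_v f).
Proof. by move=> sf vs p Up; have := sf (rcons vs v) p Up; rewrite foldr_rcons. Qed.

Lemma smooth_on_differentiable U f p : smooth_on U f -> U p -> differentiable f p.
Proof. by move=> sf; exact: (sf [::]). Qed.

(** Smoothness is the largest class of functions differentiable on U and stable, up to equality on
    U, under directional derivatives; openness of U lets derivatives respect that equality. *)
Lemma smooth_on_coind U (S : (V -> W) -> Prop) : open U ->
  (forall f, S f -> (forall p, U p -> differentiable f p) /\
    forall v, exists2 g, S g & forall p, U p -> 'D_v f p = g p) ->
  forall f, S f -> smooth_on U f.
Proof.
move=> oU HS f Sf vs.
have [g Sg fg] : exists2 g, S g & forall p, U p ->
    foldr (fun v h => fun q => 'D_v h q) f vs p = g p.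
  elim: vs => [|v vs [g Sg fg]] /=; first by exists f.
  have [_ /(_ v)[g' Sg' gg']] := HS _ Sg; exists g' => // p Up.
  by rewrite -gg'//; exact: (derive_eq_on v oU Up fg).
move=> p Up; have [/(_ _ Up) dg _] := HS _ Sg.
by apply: (differentiable_eq_on oU Up _ dg) => q Uq; rewrite fg.
Qed.

Lemma eq_smooth_on U f g : open U -> (forall q, U q -> f q = g q) ->
  smooth_on U f -> smooth_on U g.
Proof.
move=> oU fg sf.
apply: (@smooth_on_coind U (fun g => exists2 f, smooth_on U f & forall q, U q -> f q = g q)) => //.
  move=> {f sf g fg} g [f sf fg]; split.
    by move=> p Up; exact: (differentiable_eq_on oU Up fg (smooth_on_differentiable sf Up)).
  move=> v; exists ('D_v f); last by move=> p Up; apply/esym/(derive_eq_on v oU Up fg).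
  by exists ('D_v f) => //; exact: smooth_on_derive.
by exists f.
Qed.

Lemma smooth_on_cst U (c : W) : open U -> smooth_on U (cst c).
Proof.
move=> oU; apply: (@smooth_on_coind U (fun f => exists c, f = cst c)) => //; last by exists c.
move=> _ [{}c ->]; split; first by move=> p _; exact: differentiable_cst.
by move=> v; exists (cst 0); [exists 0|move=> p _; rewrite derive_cst].
Qed.

End EqOn.

Section Matrix.
Context {R : realType} {V : normedModType R} {a b : nat}.
Implicit Types (U : set V) (A : V -> 'M[R]_(a, b)).

Lemma differentiable_mxP A p :
  differentiable A p <-> forall i j, differentiable (fun q => A q i j) p.
Proof.
split=> [dA i j|dA].
  exact: (@differentiable_comp _ _ _ _ A (fun M : 'M[R]_(a, b) => M i j) p dA
            (differentiable_coord _ _ _)).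
have -> : A = \sum_(i < a) \sum_(j < b) (fun q => A q i j *: delta_mx i j : 'M[R]_(a, b)).
  apply/funext => q; rewrite {1}[A q]matrix_sum_delta fct_sumE; apply: eq_bigr => i _.
  by rewrite fct_sumE.
apply: differentiable_sum => i; apply: differentiable_sum => j.
exact: differentiableZl.
Qed.

Lemma derive_mxE A p v i j : differentiable A p ->
  ('D_v A p) i j = 'D_v (fun q => A q i j) p.
Proof. by move=> dA; rewrite derive_mx ?mxE//; exact: diff_derivable. Qed.

Lemma smooth_on_mxP U A : open U ->
  smooth_on U A <-> forall i j, smooth_on U (fun q => A q i j).
Proof.
move=> oU; split=> [sA i j|sA].
  pose S (f : V -> R) := exists2 A : V -> 'M[R]_(a, b), smooth_on U A & f = fun q => A q i j.
  suff HS f : S f -> smooth_on U f by apply: HS; exists A.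
  move: f; apply: (smooth_on_coind oU) => _ [{}A {}sA ->]; split.
    by move=> p Up; exact: ((differentiable_mxP A p).1 (smooth_on_differentiable sA Up)).
  move=> v; exists (fun q => 'D_v A q i j); first by exists ('D_v A) => //; exact: smooth_on_derive.
  by move=> p Up; rewrite derive_mxE//; exact: smooth_on_differentiable sA Up.
move: A sA; apply: (smooth_on_coind oU) => A sA.
have dA p : U p -> differentiable A p.
  by move=> Up; apply/differentiable_mxP => i j; exact: smooth_on_differentiable (sA i j) Up.
split=> // v; exists ('D_v A) => // i j.
apply: (eq_smooth_on (f := 'D_v (fun q => A q i j))) => //; last exact: smooth_on_derive.
by move=> q Uq; rewrite derive_mxE//; exact: dA.
Qed.

End Matrix.

Section Chain.
Context {R : realType} {V W X : normedModType R}.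

Lemma derive_comp (F : V -> W) (g : W -> X) p v :
  differentiable F p -> differentiable g (F p) ->
  'D_v (g \o F) p = 'D_('D_v F p) g (F p).
Proof.
move=> dF dg; rewrite deriveE; last exact: differentiable_comp.
by rewrite diff_comp//= !deriveE.
Qed.

Lemma derive_dirD (f : V -> W) p u v : differentiable f p ->
  'D_(u + v) f p = 'D_u f p + 'D_v f p.
Proof. by move=> df; rewrite !deriveE// linearD. Qed.

Lemma derive_dirZ (f : V -> W) p (k : R) v : differentiable f p ->
  'D_(k *: v) f p = k *: 'D_v f p.
Proof. by move=> df; rewrite !deriveE// linearZ. Qed.

End Chain.

Section Chain_rV.
Context {R : realType} {W : normedModType R} {m : nat}.

Lemma derive_row_sum (f : 'rV[R]_m -> W) p v : differentiable f p ->
  'D_v f p = \sum_i v 0 i *: 'D_(delta_mx 0 i) f p.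
Proof.
move=> df; rewrite deriveE// {1}[v]row_sum_delta linear_sum; apply: eq_bigr => i _.
by rewrite linearZ /= deriveE.
Qed.

End Chain_rV.

Section SmoothAlgebra.
Context {R : realType} {V : normedModType R}.
Variable U : set V.
Hypothesis oU : open U.

(* Unlike smoothness itself, membership in this class can be shown stable under
   derivation by induction; smoothness of its members then follows by
   coinduction. *)
Inductive smooth_alg : (V -> R) -> Prop :=
| SmoothBase f : smooth_on U f -> smooth_alg f
| SmoothAdd f g : smooth_alg f -> smooth_alg g -> smooth_alg (fun q => f q + g q)
| SmoothMul f g : smooth_alg f -> smooth_alg g -> smooth_alg (fun q => f q * g q)
| SmoothInv f : smooth_alg f -> (forall q, U q -> f q != 0) ->
    smooth_alg (fun q => (f q)^-1)
| SmoothComp n (W : set 'rV[R]_n) (g : 'rV[R]_n -> R) (F : V -> 'rV[R]_n) :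
    smooth_on W g -> smooth_on U F -> (forall q, U q -> W (F q)) ->
    smooth_alg (fun q => g (F q)).

Lemma smooth_alg_cst (c : R) : smooth_alg (cst c).
Proof. exact/SmoothBase/smooth_on_cst. Qed.

Lemma smooth_alg_sum (I : Type) (r : seq I) (P : pred I) (f : I -> V -> R) :
  (forall i, smooth_alg (f i)) -> smooth_alg (fun q => \sum_(i <- r | P i) f i q).
Proof.
move=> sf; elim: r => [|i r IH].
  rewrite (_ : (fun _ => _) = cst 0); first exact: smooth_alg_cst.
  by apply/funext => q; rewrite big_nil.
case Pi: (P i).
  rewrite (_ : (fun _ => _) = fun q => f i q + \sum_(i <- r | P i) f i q).
    exact: SmoothAdd.
  by apply/funext => q; rewrite big_cons Pi.
rewrite (_ : (fun _ => _) = fun q => \sum_(i <- r | P i) f i q) //.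
by apply/funext => q; rewrite big_cons Pi.
Qed.

Lemma smooth_alg_prod (I : Type) (r : seq I) (P : pred I) (f : I -> V -> R) :
  (forall i, smooth_alg (f i)) -> smooth_alg (fun q => \prod_(i <- r | P i) f i q).
Proof.
move=> sf; elim: r => [|i r IH].
  rewrite (_ : (fun _ => _) = cst 1); first exact: smooth_alg_cst.
  by apply/funext => q; rewrite big_nil.
case Pi: (P i).
  rewrite (_ : (fun _ => _) = fun q => f i q * \prod_(i <- r | P i) f i q).
    exact: SmoothMul.
  by apply/funext => q; rewrite big_cons Pi.
rewrite (_ : (fun _ => _) = fun q => \prod_(i <- r | P i) f i q) //.
by apply/funext => q; rewrite big_cons Pi.
Qed.

Lemma smooth_alg_derive f : smooth_alg f ->
  (forall p, U p -> differentiable f p) /\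
  forall v, exists2 g, smooth_alg g & forall p, U p -> 'D_v f p = g p.
Proof.
elim=> {f} [f sf|f g sf [df Df] sg [dg Dg]|f g sf [df Df] sg [dg Dg]|f sf [df Df] f0
           |n W g F sg sF UW].
- split=> [p Up|v]; first exact: smooth_on_differentiable sf Up.
  by exists ('D_v f) => //; exact/SmoothBase/smooth_on_derive.
- split=> [p Up|v]; first by apply: differentiableD; [exact: df|exact: dg].
  have [f' sf' f'E] := Df v; have [g' sg' g'E] := Dg v.
  exists (fun q => f' q + g' q); first exact: SmoothAdd.
  move=> p Up; rewrite -f'E// -g'E//.
  by apply: deriveD; apply: diff_derivable; [exact: df|exact: dg].
- split=> [p Up|v]; first by apply: differentiableM; [exact: df|exact: dg].
  have [f' sf' f'E] := Df v; have [g' sg' g'E] := Dg v.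
  exists (fun q => f q * g' q + g q * f' q).
    by apply: SmoothAdd; exact: SmoothMul.
  move=> p Up; rewrite -f'E// -g'E//.
  by apply: deriveM; apply: diff_derivable; [exact: df|exact: dg].
- split=> [p Up|v]; first by apply: differentiableV; [exact: df|exact: f0].
  have [f' sf' f'E] := Df v.
  exists (fun q => (-1) * ((f q)^-1 * (f q)^-1) * f' q).
    do 2![apply: SmoothMul => //]; first exact: smooth_alg_cst.
    by apply: SmoothMul; exact: SmoothInv.
  move=> p Up; rewrite -f'E// deriveV ?f0//; last exact/diff_derivable/df.
  by rewrite expr2 invfM mulN1r.
- have dF p : U p -> differentiable F p by exact: smooth_on_differentiable.
  have dg p : U p -> differentiable g (F p).
    by move=> Up; apply: smooth_on_differentiable sg _; exact: UW.
  split=> [p Up|v]; first by apply: (@differentiable_comp _ _ _ _ F g); [exact: dF|exact: dg].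
  (* Expanding the chain rule in coordinates leaves partial derivatives of g in fixed directions,
     composed with F: again instances of [SmoothComp]. *)
  exists (fun q => \sum_i ('D_v F q) 0 i * 'D_(delta_mx 0 i) g (F q)).
    apply: smooth_alg_sum => i; apply: SmoothMul.
      by apply/SmoothBase/(smooth_on_mxP _ oU).1; exact: smooth_on_derive.
    exact: SmoothComp (smooth_on_derive _ sg) sF UW.
  by move=> p Up; rewrite (derive_comp v (dF _ Up) (dg _ Up)) derive_row_sum//; exact: dg.
Qed.

Lemma smooth_alg_smooth f : smooth_alg f -> smooth_on U f.
Proof. by apply: (smooth_on_coind oU); exact: smooth_alg_derive. Qed.

End SmoothAlgebra.

Section SmoothMatrix.
Context {R : realType} {V : normedModType R}.
Variable U : set V.
Hypothesis oU : open U.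

Lemma smooth_on_entry a b (A : V -> 'M[R]_(a, b)) i j :
  smooth_on U A -> smooth_alg U (fun q => A q i j).
Proof. by move=> /smooth_on_mxP sA; apply/SmoothBase/sA. Qed.

Lemma smooth_on_mx a b (A : V -> 'M[R]_(a, b)) :
  (forall i j, smooth_alg U (fun q => A q i j)) -> smooth_on U A.
Proof. by move=> sA; apply/smooth_on_mxP => // i j; exact: smooth_alg_smooth. Qed.

Lemma smooth_onD a b (A B : V -> 'M[R]_(a, b)) :
  smooth_on U A -> smooth_on U B -> smooth_on U (fun q => A q + B q).
Proof.
move=> sA sB; apply: smooth_on_mx => i j.
under eq_fun do rewrite mxE.
by apply: SmoothAdd; exact: smooth_on_entry.
Qed.

Lemma smooth_onZ a b (f : V -> R) (A : V -> 'M[R]_(a, b)) :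
  smooth_on U f -> smooth_on U A -> smooth_on U (fun q => f q *: A q).
Proof.
move=> sA sB; apply: smooth_on_mx => i j.
under eq_fun do rewrite mxE.
by apply: SmoothMul; [exact: SmoothBase|exact: smooth_on_entry].
Qed.

Lemma smooth_onN a b (A : V -> 'M[R]_(a, b)) :
  smooth_on U A -> smooth_on U (fun q => - A q).
Proof.
move=> sA; under eq_fun do rewrite -scaleN1r.
by apply: (@smooth_onZ _ _ (cst (-1))) => //; exact: smooth_on_cst.
Qed.

Lemma smooth_onB a b (A B : V -> 'M[R]_(a, b)) :
  smooth_on U A -> smooth_on U B -> smooth_on U (fun q => A q - B q).
Proof. by move=> sA sB; apply: smooth_onD => //; exact: smooth_onN. Qed.

Lemma smooth_on_sum a b (I : Type) (r : seq I) (A : I -> V -> 'M[R]_(a, b)) :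
  (forall i, smooth_on U (A i)) -> smooth_on U (fun q => \sum_(i <- r) A i q).
Proof.
move=> sA; apply: smooth_on_mx => i j.
under eq_fun do rewrite summxE.
by apply: smooth_alg_sum => // k; exact: smooth_on_entry.
Qed.

Lemma smooth_onM a b c (A : V -> 'M[R]_(a, b)) (B : V -> 'M[R]_(b, c)) :
  smooth_on U A -> smooth_on U B -> smooth_on U (fun q => A q *m B q).
Proof.
move=> sA sB; apply: smooth_on_mx => i j.
under eq_fun do rewrite mxE.
by apply: smooth_alg_sum => // k; apply: SmoothMul; exact: smooth_on_entry.
Qed.

Lemma smooth_on_tr a b (A : V -> 'M[R]_(a, b)) :
  smooth_on U A -> smooth_on U (fun q => (A q)^T).
Proof.
move=> sA; apply: smooth_on_mx => i j.
under eq_fun do rewrite mxE.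
exact: smooth_on_entry.
Qed.

Lemma smooth_on_det n (A : V -> 'M[R]_n) :
  smooth_on U A -> smooth_alg U (fun q => \det (A q)).
Proof.
move=> sA; rewrite /determinant; apply: smooth_alg_sum => // s.
apply: SmoothMul; first exact: (smooth_alg_cst oU).
by apply: smooth_alg_prod => // i; exact: smooth_on_entry.
Qed.

Lemma smooth_on_invmx n (A : V -> 'M[R]_n) :
  smooth_on U A -> (forall q, U q -> A q \in unitmx) ->
  smooth_on U (fun q => invmx (A q)).
Proof.
move=> sA uA.
apply: (@eq_smooth_on _ _ _ _ (fun q => (\det (A q))^-1 *: \adj (A q))) => //.
  by move=> q Uq; rewrite /invmx uA.
apply: smooth_on_mx => i j.
under eq_fun do rewrite mxE.
apply: SmoothMul.
  apply: SmoothInv; first exact: smooth_on_det.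
  by move=> q Uq; have := uA q Uq; rewrite unitmxE unitfE.
under eq_fun do rewrite mxE /cofactor.
apply: SmoothMul; first exact: (smooth_alg_cst oU).
apply: smooth_on_det; apply: smooth_on_mx => k l.
under eq_fun do rewrite !mxE.
exact: smooth_on_entry.
Qed.

Lemma smooth_on_comp n a b (W : set 'rV[R]_n) (A : 'rV[R]_n -> 'M[R]_(a, b))
    (F : V -> 'rV[R]_n) : open W ->
  smooth_on W A -> smooth_on U F -> (forall q, U q -> W (F q)) ->
  smooth_on U (fun q => A (F q)).
Proof.
move=> oW sA sF UW; apply: smooth_on_mx => i j.
by apply: (SmoothComp (W := W) (g := fun y => A y i j)) => //; exact: ((smooth_on_mxP _ oW).1 sA).
Qed.

Lemma smooth_on_scalar a b (A : V -> 'M[R]_(a, b)) i j :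
  smooth_on U A -> smooth_on U (fun q => A q i j).
Proof. by move=> sA; exact: ((smooth_on_mxP _ oU).1 sA). Qed.

Lemma derive_smoothD a b (A B : V -> 'M[R]_(a, b)) v p : U p ->
  smooth_on U A -> smooth_on U B ->
  'D_v (fun q => A q + B q) p = 'D_v A p + 'D_v B p.
Proof.
move=> Up sA sB; apply: deriveD; apply: diff_derivable.
  exact: smooth_on_differentiable sA Up.
exact: smooth_on_differentiable sB Up.
Qed.

Lemma derive_smoothB a b (A B : V -> 'M[R]_(a, b)) v p : U p ->
  smooth_on U A -> smooth_on U B ->
  'D_v (fun q => A q - B q) p = 'D_v A p - 'D_v B p.
Proof.
move=> Up sA sB; apply: deriveB; apply: diff_derivable.
  exact: smooth_on_differentiable sA Up.
exact: smooth_on_differentiable sB Up.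
Qed.

Lemma derive_smooth_entry a b (A : V -> 'M[R]_(a, b)) v p i j : U p ->
  smooth_on U A -> 'D_v (fun q => A q i j) p = ('D_v A p) i j.
Proof. by move=> Up sA; rewrite derive_mxE//; exact: smooth_on_differentiable sA Up. Qed.

Lemma derive_smoothM a b c (A : V -> 'M[R]_(a, b)) (B : V -> 'M[R]_(b, c)) v p :
  U p -> smooth_on U A -> smooth_on U B ->
  'D_v (fun q => A q *m B q) p = 'D_v A p *m B p + A p *m 'D_v B p.
Proof.
move=> Up sA sB; apply/matrixP => i j.
have sAe k l := smooth_on_scalar k l sA; have sBe k l := smooth_on_scalar k l sB.
rewrite -derive_smooth_entry//; last exact: smooth_onM.
under eq_fun do rewrite mxE.
have -> : (fun q => \sum_k A q i k * B q k j) = \sum_k (fun q => A q i k * B q k j).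
  by apply/funext => q; rewrite fct_sumE.
have dA k l : derivable (fun q => A q k l) p v.
  by apply/diff_derivable; exact: smooth_on_differentiable (sAe k l) Up.
have dB k l : derivable (fun q => B q k l) p v.
  by apply/diff_derivable; exact: smooth_on_differentiable (sBe k l) Up.
rewrite derive_sum; last by move=> k; exact: derivableM.
rewrite !mxE -big_split; apply: eq_bigr => k _ /=.
by rewrite deriveM// !derive_smooth_entry// addrC; congr (_ + _); exact: mulrC.
Qed.

Lemma derive_smooth_tr a b (A : V -> 'M[R]_(a, b)) v p : U p ->
  smooth_on U A -> 'D_v (fun q => (A q)^T) p = ('D_v A p)^T.
Proof.
move=> Up sA; apply/matrixP => i j.
rewrite -derive_smooth_entry//; last exact: smooth_on_tr.
under eq_fun do rewrite mxE.
by rewrite mxE derive_smooth_entry.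
Qed.

Lemma derive_smooth_comm a b (A : V -> 'M[R]_(a, b)) u v p : U p ->
  smooth_on U A -> 'D_v ('D_u A) p = 'D_u ('D_v A) p.
Proof.
move=> Up sA; apply/matrixP => i j.
have sE := smooth_on_scalar i j sA.
have E w w' : ('D_w' ('D_w A) p) i j = 'D_w' ('D_w (fun q => A q i j)) p.
  rewrite -(derive_smooth_entry w' i j Up (smooth_on_derive w sA)).
  by apply: (derive_eq_on _ oU Up) => q Uq; rewrite derive_smooth_entry.
apply: etrans (E u v) (etrans _ (esym (E v u))); apply: (derive_comm oU Up).
- by move=> q; exact: smooth_on_differentiable.
- by apply: smooth_on_differentiable Up; exact: smooth_on_derive.
- by apply: smooth_on_differentiable Up; exact: smooth_on_derive.
Qed.

End SmoothMatrix.

(** * The Levi-Civita connection in coordinates *)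

Section OpenCalculus.
Context {R : realType} {V : normedModType R}.
Variable U : set V.
Hypothesis oU : open U.

Definition open_calculus : diff_calculus R V V.
Proof.
refine (@DiffCalculus R V V U (fun a b A => smooth_on U A) (fun a b u A => 'D_u A)
  _ _ _ _ _ _ _ _ _ _ _ _ _ _ _).
- by move=> a b A B; exact: eq_smooth_on.
- by move=> a b M; exact: smooth_on_cst.
- by move=> a b A B; exact: smooth_onD.
- by move=> a b A B; exact: smooth_onB.
- by move=> a b c A B; exact: smooth_onM.
- by move=> a b A; exact: smooth_on_tr.
- by move=> a A; exact: smooth_on_invmx.
- by move=> a b A u; exact: smooth_on_derive.
- by move=> a b A B u p Up; exact: derive_eq_on.
- by move=> a b M u p; exact: derive_cst.
- by move=> a b A B u p; exact: derive_smoothD.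
- by move=> a b A B u p; exact: derive_smoothB.
- by move=> a b c A B u p; exact: derive_smoothM.
- by move=> a b A u p; exact: derive_smooth_tr.
- by move=> a b A u v p Up sA; exact: (derive_smooth_comm oU v u Up sA).
(* Transparent, because later proofs simplify [dom], [smooth] and [der] to [U], [smooth_on] and
   ['D_]. *)
Defined.

Lemma derive_smoothZ a b (f : V -> R) (A : V -> 'M[R]_(a, b)) v p : U p ->
  smooth_on U f -> smooth_on U A ->
  'D_v (fun q => f q *: A q) p = 'D_v f p *: A p + f p *: 'D_v A p.
Proof.
move=> Up sf sA; apply/matrixP => i j.
have sAe := smooth_on_scalar oU i j sA.
rewrite -(derive_smooth_entry v i j Up (smooth_onZ oU sf sA)).
under eq_fun do rewrite mxE.
rewrite deriveM.
- rewrite (derive_smooth_entry v i j Up sA) !mxE addrC; congr (_ + _).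
  exact: mulrC.
- exact/diff_derivable/(smooth_on_differentiable sf Up).
- exact/diff_derivable/(smooth_on_differentiable sAe Up).
Qed.

End OpenCalculus.

Section Christoffel.
Context {R : realType} {n : nat}.
Variables (V : set 'rV[R]_n) (g : 'rV[R]_n -> 'M[R]_n).
Hypotheses (oV : open V) (sg : smooth_on V g).
Hypotheses (g_sym : forall y, V y -> (g y)^T = g y)
  (g_pos : forall y (u : 'rV[R]_n), V y -> u != 0 -> 0 < ip (g y) u u).
Implicit Types (u v w : 'rV[R]_n).

Let g_unit y : V y -> g y \in unitmx.
Proof. by move=> Vy; apply: ip_unitmx => u; exact: g_pos. Qed.

Let dg y : V y -> differentiable g y. Proof. exact: smooth_on_differentiable. Qed.

Lemma ip_inj y u v : V y -> (forall w, ip (g y) u w = ip (g y) v w) -> u = v.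
Proof.
move=> Vy uv; apply/eqP; rewrite -subr_eq0; apply/negP => /negP/(g_pos Vy).
by rewrite ipBl uv subrr ltxx.
Qed.

(* Locked, so that derivatives in distinct directions are never compared by
   unfolding them into limits. *)
Definition dmetric u y : 'M[R]_n := locked ('D_u g y).

Lemma dmetricE u y : 'D_u g y = dmetric u y.
Proof. by rewrite /dmetric -lock. Qed.

Lemma dmetric_sym u y : V y -> (dmetric u y)^T = dmetric u y.
Proof.
move=> Vy; rewrite -dmetricE -(derive_smooth_tr oV _ Vy sg).
by apply: (derive_eq_on _ oV Vy) => q; exact: g_sym.
Qed.

Lemma derive_ip y a u v : V y -> 'D_a (fun q => ip (g q) u v) y = ip (dmetric a y) u v.
Proof.
move=> Vy; rewrite /ip -dmetricE.
have su : smooth_on V (fun q => u *m g q).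
  by apply: (smooth_onM oV (A := fun=> u)) => //; exact: smooth_on_cst.
rewrite (derive_smooth_entry _ _ _ Vy); last first.
  by apply: (smooth_onM oV (B := fun=> v^T)) => //; exact: smooth_on_cst.
rewrite (derive_smoothM oV (B := fun=> v^T) _ Vy)//; last exact: smooth_on_cst.
rewrite (derive_smoothM oV (A := fun=> u) _ Vy)//; last exact: smooth_on_cst.
by rewrite !derive_cst mul0mx mulmx0 add0r addr0.
Qed.

(** The definition gives this Koszul formula for basis vectors w, and both sides are linear in w. *)
Lemma ip_christoffel y u v w : V y -> ip (g y) (christoffel g y u v) w =
  2^-1 * (ip (dmetric u y) v w + ip (dmetric v y) u w - ip (dmetric w y) u v).
Proof.
move=> Vy; rewrite {1}/ip /christoffel -(mulmxA _ _ (g y)) mulVmx ?g_unit// mulmx1.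
have dsum : dmetric w y = \sum_i w 0 i *: dmetric (delta_mx 0 i) y.
  rewrite -dmetricE (derive_row_sum w (dg Vy)); apply: eq_bigr => i _.
  by rewrite dmetricE.
rewrite mxE dsum.
have ipsum (A : 'M[R]_n) x : ip A x w = \sum_k w 0 k * ip A x (delta_mx 0 k).
  rewrite {1}[w]row_sum_delta /ip linear_sum /= mulmx_sumr summxE.
  by apply: eq_bigr => k _; rewrite linearZ /= -scalemxAr mxE.
have ipmat : ip (\sum_i w 0 i *: dmetric (delta_mx 0 i) y) u v
    = \sum_i w 0 i * ip (dmetric (delta_mx 0 i) y) u v.
  rewrite /ip mulmx_sumr mulmx_suml summxE; apply: eq_bigr => k _.
  by rewrite -scalemxAr -scalemxAl mxE.
rewrite ipmat (ipsum (dmetric u y) v) (ipsum (dmetric v y) u).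
rewrite -big_split -sumrB mulr_sumr /=.
apply: eq_bigr => k _; rewrite !mxE !derive_ip// -mulrA; congr (_ * _).
by rewrite mulrC mulrBr mulrDr.
Qed.

Lemma christoffelC y u v : V y -> christoffel g y u v = christoffel g y v u.
Proof.
move=> Vy; apply: (ip_inj Vy) => w; rewrite !ip_christoffel//.
by move: (ipC u v (dmetric_sym w Vy)); ip_atoms; lra.
Qed.

Lemma christoffel_metric y u v w : V y ->
  ip (g y) (christoffel g y u v) w + ip (g y) v (christoffel g y u w) = ip (dmetric u y) v w.
Proof.
move=> Vy; rewrite (ipC v _ (g_sym Vy)) !ip_christoffel//.
by move: (ipC w v (dmetric_sym u Vy)); ip_atoms; lra.
Qed.

Lemma christoffelD y u v v' : V y ->
  christoffel g y u (v + v') = christoffel g y u v + christoffel g y u v'.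
Proof.
move=> Vy; apply: (ip_inj Vy) => w; rewrite ipDl !ip_christoffel//.
have -> : dmetric (v + v') y = dmetric v y + dmetric v' y.
  by rewrite -!dmetricE; exact: derive_dirD (dg Vy).
have ipD0 (A B : 'M[R]_n) x z : ip (A + B) x z = ip A x z + ip B x z :> R.
  by rewrite /ip mxDr mxDl mxE.
move: (ipD0 (dmetric v y) (dmetric v' y) u w).
by move: (ipDl (dmetric u y) v v' w) (ipDr (dmetric w y) v v' u); ip_atoms; lra.
Qed.

Lemma christoffelZ y u (k : R) v : V y ->
  christoffel g y u (k *: v) = k *: christoffel g y u v.
Proof.
move=> Vy; apply: (ip_inj Vy) => w; rewrite ipZl !ip_christoffel//.
have -> : dmetric (k *: v) y = k *: dmetric v y.
  by rewrite -!dmetricE; exact: derive_dirZ (dg Vy).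
have ipZ0 (A : 'M[R]_n) x z : ip (k *: A) x z = k * ip A x z :> R.
  by rewrite /ip -scalemxAr -scalemxAl mxE.
move: (ipZ0 (dmetric v y) u w) (ipZl (dmetric u y) k v w) (ipZr (dmetric w y) k v u).
by ip_atoms; move=> -> -> ->; ring.
Qed.

(* The matrix of v |-> christoffel g y u v, in the row vector convention. *)
Definition connection_mx u y : 'M[R]_n :=
  \sum_i u 0 i *: \matrix_j christoffel g y (delta_mx 0 i) (delta_mx 0 j).

Lemma christoffelE y u v : V y -> christoffel g y u v = v *m connection_mx u y.
Proof.
move=> Vy; have lin w x : christoffel g y w x = \sum_j x 0 j *: christoffel g y w (delta_mx 0 j).
  rewrite {1}[x]row_sum_delta.
  elim: (index_enum 'I_n) => [|i r IH]; last by rewrite !big_cons christoffelD// christoffelZ// IH.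
  by rewrite !big_nil; have := christoffelZ w 0 0 Vy; rewrite !scale0r.
rewrite christoffelC// lin /connection_mx mulmx_sumr; apply: eq_bigr => i _.
rewrite -scalemxAr christoffelC// lin; congr (_ *: _).
by rewrite mulmx_sum_row; apply: eq_bigr => j _; rewrite rowK.
Qed.

Lemma smooth_on_connection_mx u : smooth_on V (connection_mx u).
Proof.
apply: smooth_on_sum => // i; apply: (smooth_onZ oV (f := cst (u 0 i))); first exact: smooth_on_cst.
have sip v w : smooth_on V (fun q => ip (g q) v w).
  apply: (smooth_on_scalar oV).
  apply: (smooth_onM oV (B := fun=> w^T)); last exact: smooth_on_cst.
  by apply: (smooth_onM oV (A := fun=> v)) => //; exact: smooth_on_cst.
pose low y := \matrix_(j, k) (2^-1 *
  ('D_(delta_mx 0 i) (fun q => ip (g q) (delta_mx 0 j) (delta_mx 0 k)) y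
   + 'D_(delta_mx 0 j) (fun q => ip (g q) (delta_mx 0 i) (delta_mx 0 k)) y
   - 'D_(delta_mx 0 k) (fun q => ip (g q) (delta_mx 0 i) (delta_mx 0 j)) y)).
apply: (@eq_smooth_on _ _ _ _ (fun y => low y *m invmx (g y))) => //.
  by move=> y Vy; apply/row_matrixP => j; rewrite rowK row_mul; congr (_ *m _);
    apply/rowP => k; rewrite !mxE.
apply: smooth_onM => //; last exact: smooth_on_invmx.
apply: smooth_on_mx => // j k; rewrite /low; under eq_fun do rewrite mxE.
apply: SmoothMul; first exact: (smooth_alg_cst oV).
apply: SmoothAdd; first by apply: SmoothAdd; apply/SmoothBase/smooth_on_derive.
under eq_fun do rewrite -mulN1r.
by apply: SmoothMul; [exact: (smooth_alg_cst oV)|apply/SmoothBase/smooth_on_derive].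
Qed.

Lemma connection_mx_metric u y : V y ->
  'D_u g y = connection_mx u y *m g y + g y *m (connection_mx u y)^T.
Proof.
move=> Vy; apply/eqP; rewrite -subr_eq0; apply/eqP; apply: bilinear_eq0_mx => v w.
have := christoffel_metric u v w Vy; rewrite !christoffelE// => e; rewrite dmetricE.
have -> : v *m (dmetric u y - (connection_mx u y *m g y + g y *m (connection_mx u y)^T)) *m w^T
  = v *m dmetric u y *m w^T - (v *m connection_mx u y *m g y *m w^T
     + v *m g y *m (w *m connection_mx u y)^T).
  by move: (connection_mx u y) => ?; mx_abel.
by rewrite mx_addE mx_oppE mx_addE -/(ip _ _ _) -e /ip subrr.
Qed.

Lemma connection_mxC u v y : V y -> v *m connection_mx u y = u *m connection_mx v y.
Proof. by move=> Vy; rewrite -!christoffelE// christoffelC. Qed.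

Lemma connection_mxD u v y : connection_mx (u + v) y = connection_mx u y + connection_mx v y.
Proof.
by rewrite /connection_mx -big_split; apply: eq_bigr => i _; rewrite mxE scalerDl.
Qed.

Lemma riemannE y u v w : V y ->
  riemann g y u v w = w *m curv (open_calculus oV) connection_mx u v y.
Proof.
move=> Vy; have E a b : nabla g a (nabla g b (cst w)) y =
    w *m 'D_a (connection_mx b) y + w *m connection_mx b y *m connection_mx a y.
  have nE q : V q -> nabla g b (cst w) q = w *m connection_mx b q.
    by move=> Vq; rewrite /nabla derive_cst add0r christoffelE.
  rewrite {1}/nabla christoffelE// nE// (derive_eq_on _ oV Vy nE).
  rewrite (derive_smoothM oV (A := fun=> w) _ Vy) ?derive_cst ?mul0mx ?add0r//.
    exact: smooth_on_cst.
  exact: smooth_on_connection_mx.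
rewrite /riemann !E curvE /=.
by move: ('D_u _ y) ('D_v _ y) (connection_mx u y) (connection_mx v y) => *; mx_abel.
Qed.

End Christoffel.

Lemma derive_smooth_sum (R : realType) (V : normedModType R) (U : set V) (oU : open U)
    a b (I : Type) (r : seq I) (A : I -> V -> 'M[R]_(a, b)) v p : U p ->
  (forall i, smooth_on U (A i)) ->
  'D_v (fun q => \sum_(i <- r) A i q) p = \sum_(i <- r) 'D_v (A i) p.
Proof.
move=> Up sA; elim: r => [|i r IH].
  rewrite big_nil -[RHS](derive_cst (0 : 'M[R]_(a, b)) p v).
  by apply: (derive_eq_on _ oU Up) => q _; rewrite big_nil.
rewrite big_cons -IH -(derive_smoothD _ Up (sA i))//; last exact: smooth_on_sum.
by apply: (derive_eq_on _ oU Up) => q _; rewrite big_cons.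
Qed.

Arguments derive_smooth_sum {R V U} oU {a b I} r A v p.

(** * Pull-back of the Levi-Civita connection along a map *)

Section AlongMap.
Context {R : realType} {m n : nat}.
Variables (U : set 'rV[R]_m) (V : set 'rV[R]_n) (g : 'rV[R]_n -> 'M[R]_n).
Variable F : 'rV[R]_m -> 'rV[R]_n.
Hypotheses (oU : open U) (oV : open V) (sg : smooth_on V g).
Hypotheses (g_sym : forall y, V y -> (g y)^T = g y)
  (g_pos : forall y (u : 'rV[R]_n), V y -> u != 0 -> 0 < ip (g y) u u).
Hypotheses (sF : smooth_on U F) (UV : forall q, U q -> V (F q)).

Implicit Types (u v q : 'rV[R]_m) (w y : 'rV[R]_n).
Local Notation T := (jacobian F).
Local Notation Gam := (connection_mx g).

Definition connection_along u q := Gam (u *m T q) (F q).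
Local Notation Om := connection_along.

Lemma derive_map v q : U q -> 'D_v F q = v *m T q.
Proof. by move=> Uq; apply: deriveEjacobian; exact: smooth_on_differentiable sF Uq. Qed.

Let dT := fun q => \matrix_i 'D_(delta_mx 0 i) F q.
Let TE q : U q -> dT q = T q.
Proof. by move=> Uq; apply/row_matrixP => i; rewrite rowK derive_map// rowE. Qed.

Lemma smooth_on_jacobian : smooth_on U T.
Proof.
apply: (eq_smooth_on (f := dT)) => //; apply: smooth_on_mx => // i j.
under eq_fun do rewrite mxE.
by apply: smooth_on_entry => //; exact: smooth_on_derive.
Qed.

Lemma smooth_on_metric_along : smooth_on U (fun q => g (F q)).
Proof. exact: (smooth_on_comp oU oV sg sF UV). Qed.

Let sGamF w : smooth_on U (fun q => Gam w (F q)).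
Proof. by apply: (smooth_on_comp oU oV _ sF UV); exact: smooth_on_connection_mx. Qed.

(** Separates the two ways in which q enters Gam (u T q) (F q): the moving direction becomes scalar
    coefficients of matrices with fixed directions. *)
Let GamE w y : Gam w y = \sum_i w 0 i *: Gam (delta_mx 0 i) y.
Proof.
rewrite {1}/connection_mx; apply: eq_bigr => i _; congr (_ *: _).
rewrite /connection_mx (bigD1 i)//= big1 ?addr0; last first.
  by move=> j ji; rewrite mxE (negbTE ji) andbF scale0r.
by rewrite mxE !eqxx scale1r.
Qed.

Let suT u i : smooth_on U (fun q => (u *m T q) 0 i).
Proof.
apply: (smooth_on_scalar oU); apply: (smooth_onM oU (A := fun=> u)).
  exact: smooth_on_cst.
exact: smooth_on_jacobian.
Qed.

Lemma smooth_on_connection_along u : smooth_on U (Om u).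
Proof.
apply: (eq_smooth_on (f := fun q => \sum_i (u *m T q) 0 i *: Gam (delta_mx 0 i) (F q))) => //.
  by move=> q _; rewrite -GamE.
by apply: smooth_on_sum => // i; exact: smooth_onZ.
Qed.

Let derive_uT u v q : U q -> 'D_u (fun r => v *m T r) q = v *m 'D_u T q.
Proof.
move=> Uq; rewrite (derive_smoothM oU (A := fun=> v) _ Uq) ?derive_cst ?mul0mx ?add0r//.
  exact: smooth_on_cst.
exact: smooth_on_jacobian.
Qed.

(** Leibniz rule: the first term differentiates the direction v T, the second the point F q. *)
Lemma derive_connection_along u v q : U q ->
  'D_u (Om v) q = Gam (v *m 'D_u T q) (F q) + 'D_(u *m T q) (Gam (v *m T q)) (F q).
Proof.
move=> Uq.
have dGam i : differentiable (Gam (delta_mx 0 i)) (F q).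
  by apply: smooth_on_differentiable (UV Uq); exact: smooth_on_connection_mx.
pose Om' r := \sum_i (v *m T r) 0 i *: Gam (delta_mx 0 i) (F r).
rewrite (derive_eq_on (g := Om') _ oU Uq); last first.
  by move=> r _; exact: GamE.
rewrite (derive_smooth_sum oU _ _ _ q Uq)//; last by move=> i; exact: smooth_onZ.
rewrite [Gam (v *m 'D_u T q) _]GamE.
have -> : 'D_(u *m T q) (Gam (v *m T q)) (F q) =
    \sum_i (v *m T q) 0 i *: 'D_(u *m T q) (Gam (delta_mx 0 i)) (F q).
  have sG w : smooth_on V (Gam w) by exact: smooth_on_connection_mx.
  pose Gam' y := \sum_i (v *m T q) 0 i *: Gam (delta_mx 0 i) y.
  rewrite (derive_eq_on (g := Gam') _ oV (UV Uq)); last first.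
    by move=> r _; exact: GamE.
  rewrite (derive_smooth_sum oV _ _ _ _ (UV Uq))//; last first.
    by move=> i; apply: (smooth_onZ oV (f := cst _)) => //; exact: smooth_on_cst.
  apply: eq_bigr => i _.
  rewrite (derive_smoothZ oV (f := cst _) _ (UV Uq))//; last exact: smooth_on_cst.
  by rewrite derive_cst scale0r add0r.
rewrite -big_split; apply: eq_bigr => i _ /=.
rewrite (derive_smoothZ oU u Uq (suT v i) (sGamF _)).
congr (_ *: _ + _ *: _).
  rewrite (derive_smooth_entry u 0 i Uq (A := fun r => v *m T r)); last first.
    by apply: (smooth_onM oU (A := fun=> v)); [exact: smooth_on_cst|exact: smooth_on_jacobian].
  by rewrite derive_uT.
rewrite -(derive_map u Uq).
apply: (derive_comp u _ (dGam i)); exact: smooth_on_differentiable sF Uq.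
Qed.

Lemma jacobian_derive_comm u v q : U q -> v *m 'D_u T q = u *m 'D_v T q.
Proof.
move=> Uq; rewrite -!derive_uT//.
have E a b : 'D_a (fun r => b *m T r) q = 'D_a ('D_b F) q.
  by apply: (derive_eq_on _ oU Uq) => r Ur; rewrite derive_map.
apply: etrans (E u v) (etrans _ (esym (E v u))).
exact: (derive_smooth_comm oU v u Uq sF).
Qed.

Lemma metric_along u q : U q ->
  'D_u (fun r => g (F r)) q = Om u q *m g (F q) + g (F q) *m (Om u q)^T.
Proof.
move=> Uq; rewrite /connection_along -(connection_mx_metric oV sg g_sym g_pos _ (UV Uq)).
rewrite -(derive_map u Uq); apply: (derive_comp u).
  exact: smooth_on_differentiable sF Uq.
by apply: smooth_on_differentiable sg _; exact: UV.
Qed.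

Lemma torsion_free_along u v q : U q ->
  v *m covd (open_calculus oU) Om u T q = u *m covd (open_calculus oU) Om v T q.
Proof.
move=> Uq; rewrite !covdE !mulmxDr /= (jacobian_derive_comm u v Uq); congr (_ + _).
by rewrite !mulmxA /connection_along; apply: (connection_mxC oV sg g_sym g_pos); exact: UV.
Qed.

(** The terms containing second derivatives of F are symmetric in u and v, so they cancel and the
    curvature pulls back as a tensor. *)
Lemma curv_along u v q : U q ->
  curv (open_calculus oU) Om u v q = curv (open_calculus oV) Gam (u *m T q) (v *m T q) (F q).
Proof.
move=> Uq; rewrite !curvE /= !derive_connection_along// (jacobian_derive_comm u v Uq).
rewrite /connection_along; move: ('D_(u *m T q) _ _) ('D_(v *m T q) _ _) => A B.
by move: (Gam _ _) => C; rewrite opprD addrACA subrr add0r.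
Qed.

End AlongMap.

(** * Curvature of a Kaehler metric of constant holomorphic sectional curvature *)

Section KaehlerCurvature.
Context {R : realType} {n : nat}.
Variables (V : set 'rV[R]_n) (g : 'rV[R]_n -> 'M[R]_n) (J : 'M[R]_n) (c : R).
Hypotheses (oV : open V) (sg : smooth_on V g).
Hypotheses (g_sym : forall y, V y -> (g y)^T = g y)
  (g_pos : forall y (u : 'rV[R]_n), V y -> u != 0 -> 0 < ip (g y) u u).
Hypotheses (JJ : J *m J = - 1%:M)
  (J_iso : forall y (u v : 'rV[R]_n), V y -> ip (g y) (u *m J) (v *m J) = ip (g y) u v)
  (J_par : forall y (u w : 'rV[R]_n), V y ->
     christoffel g y u (w *m J) = christoffel g y u w *m J)
  (hol : forall y (u : 'rV[R]_n), V y ->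
     ip (g y) (riemann g y u (u *m J) (u *m J)) u = 4 * c * ip (g y) u u ^+ 2).
Implicit Types (u v w y : 'rV[R]_n).

Lemma connection_mx_comm u y : V y ->
  J *m connection_mx g u y = connection_mx g u y *m J.
Proof.
move=> Vy; apply/row_matrixP => i; rewrite !rowE.
by rewrite !mulmxA -!(christoffelE oV sg g_sym g_pos)// J_par.
Qed.

Local Notation curvature := (curv (open_calculus oV) (connection_mx g)).

Let sGam u : smooth_on V (connection_mx g u).
Proof. exact: smooth_on_connection_mx. Qed.

Let curvD u u' v y : V y -> curvature (u + u') v y = curvature u v y + curvature u' v y.
Proof.
move=> Vy; rewrite !curvE /=.
have -> : 'D_(u + u') (connection_mx g v) y
    = 'D_u (connection_mx g v) y + 'D_u' (connection_mx g v) y.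
  by apply: derive_dirD; exact: smooth_on_differentiable (sGam v) Vy.
have -> : 'D_v (connection_mx g (u + u')) y
    = 'D_v (connection_mx g u) y + 'D_v (connection_mx g u') y.
  rewrite -(derive_smoothD v Vy (sGam u) (sGam u')).
  by apply: (derive_eq_on _ oV Vy) => q _; exact: connection_mxD.
rewrite connection_mxD; move: ('D_u _ _) ('D_u' _ _) ('D_v _ _) ('D_v _ _) => A B C E.
by move: (connection_mx g u y) (connection_mx g u' y) (connection_mx g v y) => *; mx_abel.
Qed.

Lemma space_form_curvature u v xi eta y : V y ->
  ip (g y) (xi *m curvature u v y) eta = c * space_form (mulmxr J) (ip (g y)) u v xi eta.
Proof.
move=> Vy; pose K u v xi eta := ip (g y) (xi *m curvature u v y) eta.
apply: (@holomorphic_curvature R 'rV[R]_n (mulmxr J) (ip (g y)) _ _ _ _ K).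
- by move=> x /=; rewrite -mulmxA JJ mxNr mulmx1.
- by move=> x x' z; exact: ipDl.
- by move=> x z; apply: ipC; exact: g_sym.
- by move=> x z; exact: J_iso.
- by move=> x x' z s t; rewrite /K curvD// mxDr ipDl.
- by move=> x z s t; rewrite /K curvC mxNr ipNl.
- move=> x z s t; rewrite /K.
  have := @curv_skew _ _ _ _ (open_calculus oV) _ sGam g x z y sg _ Vy.
  move=> /(_ (fun w q Vq => connection_mx_metric oV sg g_sym g_pos w Vq)).
  move/(congr1 (fun M : 'M[R]_n => (t *m M *m s^T) 0 0)).
  rewrite mxDr mxDl mx0r mx0l [RHS]mxE mx_addE => e.
  have -> : ip (g y) (s *m curvature x z y) t = (t *m (g y *m (curvature x z y)^T) *m s^T) 0 0.
    by rewrite (ipC _ _ (g_sym Vy)) /ip mxtrM !mxA.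
  have -> : ip (g y) (t *m curvature x z y) s = (t *m (curvature x z y *m g y) *m s^T) 0 0.
    by rewrite /ip !mxA.
  by apply/eqP; rewrite -addr_eq0 e.
- move=> x z s t; rewrite /K -!ipDl.
  (* Bianchi for the identity map, whose differential is the constant matrix 1; torsion-freeness is
     then the symmetry of the Christoffel symbols. *)
  have T1 a b q : V q -> b *m covd (open_calculus oV) (connection_mx g) a (fun=> 1%:M) q
      = b *m connection_mx g a q.
    by move=> Vq; rewrite covdE /= derive_cst add0r mul1mx.
  have /= := @bianchi _ _ _ _ (open_calculus oV) (connection_mx g) (fun=> 1%:M) sGam.
  move=> /(_ (smooth_on_cst _ oV)).
  move=> /(_ _ x z s y Vy) => B.
  have := B; rewrite !mulmx1 => -> //; first by rewrite ip0l.
  by move=> a b q Vq; rewrite !T1//; exact: connection_mxC oV sg g_sym g_pos _ _ _ Vq.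
- move=> x z s t; rewrite /K /= -mulmxA.
  rewrite (curv_comm (U := open_calculus oV) sGam x z Vy (fun w q => @connection_mx_comm w q)).
  by rewrite mulmxA J_iso.
- move=> x; rewrite /K /= -(riemannE oV sg g_sym g_pos)//; exact: hol.
Qed.

End KaehlerCurvature.

(** * CR-submanifolds of complex space forms *)

(** Values of [cinv] are meaningful only on the image of the chart, so the preimage under [cinv] is
    intersected with that open image. *)
Lemma local_dom_open (R : realType) (m n : nat) (S T : topologicalType) (f : S -> T)
    (phi : chart R S m) (psi : chart R T n) :
  continuous f -> open (local_dom f phi psi).
Proof.
move=> cf; rewrite openE => _ [x [xd fx] <-].
have oB : open (cdom phi `&` f @^-1` cdom psi).
  apply: openI; first exact: cdom_open.
  by apply: open_comp; [move=> ? _; exact: cf|exact: cdom_open].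
have nB : nbhs (cmap phi x) (cinv phi @^-1` (cdom phi `&` f @^-1` cdom psi)).
  apply: (cinv_continuous xd); rewrite (cmapK xd).
  by apply: open_nbhs_nbhs; split.
have nI : nbhs (cmap phi x) (cmap phi @` cdom phi).
  by apply: open_nbhs_nbhs; split; [exact: cimg_open|exists x].
apply: filterS2 nB nI => y By [z zd zy].
by exists z => //; split => //; move: By; rewrite -zy /= (cmapK zd) => -[].
Qed.

Lemma Jmx_sqr (R : realType) (n : nat) : Jmx R n *m Jmx R n = - 1%:M.
Proof.
rewrite /Jmx mulmx_block !mul0mx !mulmx0 mul1mx mulmx1 !addr0 !add0r.
by rewrite [in RHS]scalar_mx_block opp_block_mx oppr0.
Qed.

Section RowSpace.
Context {R : realType} {N : nat}.
Variable g : 'M[R]_N.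
Hypotheses (g_sym : g^T = g) (g_pos : forall u : 'rV[R]_N, u != 0 -> 0 < ip g u u).

Lemma orthogonal_decomposition (r : nat) (S : 'M[R]_(r, N)) (x : 'rV[R]_N) :
  exists2 s : 'rV[R]_N, (s <= S)%MS & forall b : 'rV[R]_N, (b <= S)%MS -> ip g (x - s) b = 0.
Proof.
(* The rows of [S] may be dependent; passing to a basis makes the Gram matrix invertible. *)
have [B [Bfree BS]] : exists B : 'M[R]_(\rank S, N), row_free B /\ (B :=: S)%MS.
  by exists (row_base S); split; [exact: row_base_free|exact: eq_row_base].
pose G := B *m g *m B^T.
have uG : G \in unitmx.
  apply: ip_unitmx => u u0; have -> : ip G u u = ip g (u *m B) (u *m B).
    by rewrite /ip /G mxtrM !mxA.
  apply: g_pos; apply: contra u0 => /eqP uB; apply/eqP.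
  apply: (row_free_inj Bfree).
  by rewrite mul0mx.
exists (x *m g *m B^T *m invmx G *m B).
  by rewrite (submx_trans (submxMl _ _))// BS.
move=> b; rewrite -BS => /submxP[t ->].
rewrite ipBl /ip mxtrM.
have -> : x *m g *m B^T *m invmx G *m B *m g *m (B^T *m t^T)
    = x *m g *m B^T *m (invmx G *m G) *m t^T.
  by rewrite /G; move: (invmx _) => H; rewrite !mxA.
by rewrite mulVmx// mulmx1 !mxA subrr.
Qed.

End RowSpace.

Lemma kernel_row (R : realType) (r p : nat) (A : 'M[R]_(r, p)) : (p < r)%N ->
  exists2 e : 'rV[R]_r, e != 0 & e *m A = 0.
Proof.
move=> pr; have k0 : kermx A != 0.
  by rewrite -mxrank_eq0 mxrank_ker subn_eq0 -ltnNge (leq_ltn_trans (rank_leq_col A)).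
exists (nz_row (kermx A)); first by rewrite nz_row_eq0.
by apply/sub_kermxP; exact: nz_row_sub.
Qed.

Section CRSubmanifold.
Context {R : realType} {m n : nat} {M : riemannian R m} {N : kaehler R n}.
Variables (f : M -> N) (c : R) (k : nat).
Hypotheses (c0 : c != 0) (csf : complex_space_form c N) (iso : isometric_immersion f).
Hypotheses (cr : CR_submanifold f k) (k2 : (2 <= k)%N) (sp : semi_parallel f).
Variables (phi : chart R M m) (psi : chart R N (n + n)).
Hypotheses (aphi : atlas phi) (apsi : atlas psi).

Let U := local_dom f phi psi.
Let V := cmap psi @` cdom psi.
Let F := local_expr f phi psi.
Let g := metric psi.
Let gam := metric phi.
Let gF (q : 'rV[R]_m) := g (F q).
Let J := Jmx R n.
Let T := jacobian F.

Let oU : open U. Proof. by apply: local_dom_open; case: iso. Qed.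
Let oV : open V. Proof. exact: cimg_open. Qed.
Let sg : smooth_on V g. Proof. exact: metric_smooth. Qed.
Let g_sym y : V y -> (g y)^T = g y.
Proof. by case=> x xd <-; exact: (Defs.metric_sym apsi xd). Qed.
Let g_pos y (u : 'rV[R]_(n + n)) : V y -> u != 0 -> 0 < ip (g y) u u.
Proof. by case=> x xd <-; exact: (Defs.metric_pos apsi xd). Qed.
Let sF : smooth_on U F. Proof. by case: iso => _ /(_ _ _ aphi apsi)[]. Qed.
Let UV q : U q -> V (F q).
Proof. by case=> x [xd fx] <-; exists (f x) => //; rewrite /F /local_expr (cmapK xd). Qed.
Let UW q : U q -> (cmap phi @` cdom phi) q.
Proof. by case=> x [xd fx] <-; exists x. Qed.
Let sgam : smooth_on U gam.
Proof. by move=> vs p Up; exact: (metric_smooth aphi vs (UW Up)). Qed.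
Let gam_sym q : U q -> (gam q)^T = gam q.
Proof. by case/UW=> x xd <-; exact: (Defs.metric_sym aphi xd). Qed.
Let gam_pos q (u : 'rV[R]_m) : U q -> u != 0 -> 0 < ip (gam q) u u.
Proof. by case/UW=> x xd <-; exact: (Defs.metric_pos aphi xd). Qed.

Let K := open_calculus oU.
Let Om := connection_along g F.
Let om := connection_mx gam.
Let P := tangent_J T gF J.
Let b q := ip (gF q).

Let isoT q (u v : 'rV[R]_m) : U q -> ip (gF q) (u *m T q) (v *m T q) = ip (gam q) u v.
Proof.
move=> Uq; have [_ /(_ _ _ aphi apsi)[_ /(_ q u v Uq)]] := iso.
by rewrite !(derive_map sF _ Uq).
Qed.

Let first_form_gam q : U q -> first_form T gF q = gam q.
Proof.
move=> Uq; apply/eqP; rewrite -subr_eq0; apply/eqP; apply: bilinear_eq0_mx => u v.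
rewrite first_formE.
have -> : u *m (T q *m gF q *m (T q)^T - gam q) *m v^T =
    u *m T q *m gF q *m (v *m T q)^T - u *m gam q *m v^T.
  by move: (gF q) (gam q) (T q) => *; mx_abel.
by rewrite mx_addE mx_oppE -!/(ip _ _ _) isoT// subrr.
Qed.

Let T_inj q (u : 'rV[R]_m) : U q -> u *m T q = 0 -> u = 0.
Proof.
move=> Uq uT; apply/eqP/negP => /negP/(gam_pos Uq).
by rewrite -isoT// uT ip0l ltxx.
Qed.

Let sT : smooth_on U T. Proof. exact: smooth_on_jacobian oU sF. Qed.
Let sgF : smooth_on U gF. Proof. exact: smooth_on_metric_along oU oV sg sF UV. Qed.
Let sOm u : smooth_on U (Om u).
Proof. exact: (smooth_on_connection_along oU oV sg g_pos sF UV u). Qed.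
Let som u : smooth_on U (om u).
Proof. exact: (smooth_on_connection_mx oU sgam gam_pos u). Qed.

Let JJ : J *m J = - 1%:M. Proof. exact: Jmx_sqr. Qed.

Let J_herm y (u v : 'rV[R]_(n + n)) : V y -> ip (g y) (u *m J) (v *m J) = ip (g y) u v.
Proof. by case=> x xd <-; exact: (Defs.metric_hermitian u v apsi xd). Qed.

Let J_iso q : U q -> J *m gF q *m J^T = gF q.
Proof.
move=> Uq; apply/eqP; rewrite -subr_eq0; apply/eqP; apply: bilinear_eq0_mx => u v.
have -> : u *m (J *m gF q *m J^T - gF q) *m v^T =
    u *m J *m gF q *m (v *m J)^T - u *m gF q *m v^T.
  by move: (gF q) (J) => *; mx_abel.
by rewrite mx_addE mx_oppE -!/(ip _ _ _) J_herm ?subrr//; exact: UV.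
Qed.

Let J_chr y (u w : 'rV[R]_(n + n)) : V y ->
  christoffel g y u (w *m J) = christoffel g y u w *m J.
Proof.
case=> x xd <-; have := J_parallel u w apsi xd.
by rewrite /nabla !derive_cst !add0r.
Qed.

Let hol y (u : 'rV[R]_(n + n)) : V y ->
  ip (g y) (riemann g y u (u *m J) (u *m J)) u = 4 * c * ip (g y) u u ^+ 2.
Proof. by case=> x xd <-; case: csf => _ _ /(_ psi x u apsi xd). Qed.

Let nabla_alongE u xi q : U q -> nabla_along f phi psi u xi q = covd K Om u xi q.
Proof.
move=> Uq; rewrite /nabla_along covdE /= -/F (christoffelE oV sg g_sym g_pos); last exact: UV.
by rewrite (derive_map sF _ Uq).
Qed.

Let second_formE u v q : U q -> second_form f phi psi u v q = v *m shape_mx T Om om (U := K) u q.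
Proof.
move=> Uq; rewrite /second_form nabla_alongE// shape_mxE -/F.
rewrite (derive_map sF _ Uq) /nabla derive_cst add0r.
rewrite (christoffelE oU sgam gam_sym gam_pos)// -/om mulmxBr !mulmxA -/T; congr (_ - _).
rewrite -(@covd_mull _ _ _ _ K Om _ _ u v T)//.
by apply: covd_eq => // r Ur; rewrite (derive_map sF _ Ur).
Qed.

Let normal_nablaE u xi q : U q ->
  normal_nabla f phi psi u xi q = normal_covd T gF Om (U := K) u xi q.
Proof.
move=> Uq; rewrite /normal_nabla /normal_part nabla_alongE// /normal_covd normal_projE.
by rewrite first_formE.
Qed.

Let riemann_gamE q u v w : U q -> riemann gam q u v w = w *m curv K om u v q.
Proof. exact: (riemannE oU sgam gam_sym gam_pos). Qed.

Local Notation H := (shape_mx (U := K) T Om om).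
Local Notation ncovd := (normal_covd (U := K) T gF Om).

Let semi_par (u v z w : 'rV[R]_m) q : U q ->
  ncovd u (ncovd v (fun r => w *m H z r)) q - ncovd v (ncovd u (fun r => w *m H z r)) q
  - w *m H (z *m curv K om u v q) q - w *m curv K om u v q *m H z q = 0.
Proof.
move=> Uq; have := sp aphi apsi Uq u v z w.
have E a d : normal_nabla f phi psi a (normal_nabla f phi psi d (second_form f phi psi z w)) q
    = ncovd a (ncovd d (fun r => w *m H z r)) q.
  apply: etrans (normal_nablaE _ _ Uq) _.
  (* The inner fields are differentiated, so they must agree on all of [U], not merely at [q]. *)
  congr (normal_proj _ _ _ _); apply: covd_eq => // r Ur.
  apply: etrans (normal_nablaE _ _ Ur) _; congr (normal_proj _ _ _ _).
  by apply: covd_eq => // t Ut; rewrite second_formE.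
rewrite (second_formE (riemann (metric phi) q u v z) w Uq).
rewrite (second_formE z (riemann (metric phi) q u v w) Uq).
have Rz : riemann (metric phi) q u v z = z *m curv K om u v q by exact: riemann_gamE.
have Rw : riemann (metric phi) q u v w = w *m curv K om u v q by exact: riemann_gamE.
rewrite Rz Rw => <-; congr (_ - _ - _).
by rewrite -(E u v) -(E v u).
Qed.

Let gF_sym q : U q -> (gF q)^T = gF q. Proof. by move=> Uq; exact/g_sym/UV. Qed.
Let gF_pos q (u : 'rV[R]_(n + n)) : U q -> u != 0 -> 0 < ip (gF q) u u.
Proof. by move=> Uq; apply: g_pos; exact: UV. Qed.

Let tangent_J_unique q (x z : 'rV[R]_m) : U q ->
  (forall y : 'rV[R]_m, ip (gF q) (x *m T q *m J) (y *m T q) = ip (gF q) (z *m T q) (y *m T q)) ->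
  x *m P q = z.
Proof.
move=> Uq xz; apply: (ip_inj gam_pos Uq) => y; rewrite -!isoT// -xz.
exact: (tangent_J_ip (U := K) J gF_pos T_inj Uq).
Qed.

Local Notation S q := (holo_space f phi psi q).

Let JJr (x : 'rV[R]_(n + n)) : x *m J *m J = - x.
Proof. by rewrite -mulmxA JJ mulmxN mulmx1. Qed.

Let holoJ q (s : 'rV[R]_(n + n)) : (s <= S q)%MS -> (s *m J <= T q)%MS.
Proof.
rewrite sub_capmx => /andP[sT' /submxP[t tE]]; apply/submxP; exists (- t).
by rewrite tE mulmxA JJr mulNmx.
Qed.

Let holo_tangent q (s : 'rV[R]_(n + n)) : (s <= S q)%MS -> (s <= T q)%MS.
Proof. by rewrite sub_capmx => /andP[]. Qed.

Let tangent_J_holo q (x z : 'rV[R]_m) : U q -> x *m T q *m J = z *m T q -> x *m P q = z.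
Proof. by move=> Uq xz; apply: tangent_J_unique => // y; rewrite xz. Qed.

(** Let s be the D-part of x. J maps the remainder into the normal space, so P x = J s; hence J P x
    = - s is tangent and equals P P x. *)
Let CR q : U q -> P q *m T q *m J = P q *m P q *m T q.
Proof.
move=> Uq; apply/row_matrixP => i; rewrite !rowE !mulmxA; set x := delta_mx 0 i.
have [s sS orth] := orthogonal_decomposition (fun u => @gF_pos q u Uq) (S q) (x *m T q).
have /submxP[t tE] := holoJ sS; have /submxP[x' x'E] := holo_tangent sS.
have xP : x *m P q = t.
  apply: tangent_J_unique => // y.
  have -> : x *m T q *m J = (x *m T q - s) *m J + s *m J by rewrite -mulmxDl subrK.
  rewrite ipDl tE; case: cr => _ /(_ phi psi q aphi apsi Uq) H.
  rewrite [X in X + _](H (x *m T q - s) (y *m T q)) ?add0r ?submxMl//; split=> //.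
  by rewrite addmx_sub ?submxMl// eqmx_opp holo_tangent.
rewrite xP -tE JJr; have -> : t *m P q = - x'.
  by apply: tangent_J_holo => //; rewrite -tE JJr x'E mulNmx.
by rewrite x'E mulNmx.
Qed.

Let holo_dim q (z : 'rV[R]_m) : U q -> exists x : 'rV[R]_m,
  [/\ x *m P q *m P q = - x, x != 0, ip (gF q) (x *m T q) (z *m T q) = 0 &
      ip (gF q) (x *m P q *m T q) (z *m T q) = 0].
Proof.
move=> Uq; case: cr => /(_ phi psi q aphi apsi Uq) rk _.
pose B := row_base (S q); pose a := gF q *m (z *m T q)^T.
(* Two columns, for the pairings of e and of J e with z, against a rank 2 k of at least 4. *)
have r2 : (1 + 1 < \rank (S q))%N by rewrite rk -addnn; lia.
have [e e0] := kernel_row (B *m row_mx a (J *m a)) r2.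
rewrite mulmxA mul_mx_row -row_mx0 => /eq_row_mx[ea eJa].
have eS : (e *m B <= S q)%MS by rewrite (submx_trans (submxMl _ _))// eq_row_base.
have /submxP[x xE] := holo_tangent eS; have /submxP[y yE] := holoJ eS.
have xP : x *m P q = y by apply: tangent_J_holo => //; rewrite -xE yE.
exists x; split.
- by rewrite xP; apply: tangent_J_holo => //; rewrite -yE JJr xE mulNmx.
- apply: contra e0 => /eqP x0; apply/eqP; apply: (row_free_inj (row_base_free (S q))).
  by rewrite mul0mx -/B xE x0 mul0mx.
- by rewrite -xE /ip -mulmxA -/a ea mxE.
- by rewrite xP -yE /ip -mulmxA -/a -mulmxA eJa mxE.
Qed.

Lemma CR_semi_parallel_holomorphic q (a : 'rV[R]_(n + n)) :
  U q -> holo_orth f phi psi q a -> a = 0.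
Proof.
move=> Uq ha; case: (ha) => /submxP[w wE] _; apply/eqP; apply: contraT => a0; exfalso.
apply: (semi_parallel_holo_dim (U := K) (T := T) (g := gF) (J := J) (c := c) (Om := Om) (om := om)
  sT sgF sOm som gF_sym gF_pos T_inj _ _ _ _ JJ J_iso _ CR c0 _ holo_dim semi_par Uq).
- by move=> u r Ur; exact: (metric_along oV sg g_sym g_pos sF UV).
- by move=> u v r Ur; exact: (torsion_free_along oU oV sg g_sym g_pos sF UV).
- move=> u r Ur; rewrite (der_eq (d := K) (B := gam) u Ur); last exact: first_form_gam.
  by rewrite first_form_gam//; exact: (connection_mx_metric oU sgam gam_sym gam_pos).
- by move=> u v r Ur; exact: (connection_mxC oU sgam gam_sym gam_pos).
- by move=> u r Ur; exact: (connection_mx_comm oV sg g_sym g_pos J_chr _ (UV Ur)).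
- move=> u v xi eta r Ur; rewrite (curv_along oU oV sg g_pos sF UV _ _ Ur).
  exact: (space_form_curvature oV sg g_sym g_pos JJ J_herm J_chr hol _ _ _ _ (UV Ur)).
exists w; last by apply: contra a0 => /eqP w0; rewrite wE w0 mul0mx.
(* The CR condition makes J a normal, so its tangential part P w is zero. *)
apply: tangent_J_unique => // y; case: cr => _ /(_ phi psi q aphi apsi Uq) H.
by rewrite mul0mx ip0l -[w *m T q]wE; apply: H => //; exact: submxMl.
Qed.

End CRSubmanifold.

Theorem corollary1p1 (R : realType) (c : R) (n : nat) (N : kaehler R n) :
  c != 0 -> complex_space_form c N ->
  ~ exists (m : nat) (M : riemannian R m) (f : M -> N) (k : nat),
      [/\ isometric_immersion f, CR_submanifold f k, proper_submanifold f,
          (2 <= k)%N & semi_parallel f].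
Proof.
move=> c0 csf [m [M [f [k [iso cr [nholo _] k2 sp]]]]]; apply: nholo => phi psi p aphi apsi Up a.
exact: (CR_semi_parallel_holomorphic c0 csf iso cr k2 sp aphi apsi Up).
Qed.
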